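(* Let $G$ be a non-abelian $2$-group of order $16$ of nilpotency class $2$, i.e. $G$ is one of the six groups $G_1,\dots,G_6$ below. For each $\mu\in\mathrm{Irr}(Z(G)\mid G')$ let $H\le G$ and the linear character $\psi_\mu$ of $H$ be as listed (where $(\cdot)^{1/2}$ denotes a square root in $\mathbb{C}$): $G_1=\langle x, y, z : x^4=y^2=z^2=1,\ [x, y]=[x,z]=1,\ [y, z]=x^2\rangle$; $Z(G)=\langle x\rangle$, $G'=\langle x^2\rangle$; $H=\langle x,y\rangle$; $\psi_\mu(x)=\mu(x)$, $\psi_\mu(y)=1$. $G_2=\langle x, y : x^8=y^2=1,\ [x, y]=x^4\rangle$; $Z(G)=\langle x^2\rangle$, $G'=\langle x^4\rangle$; $H=\langle x^2,y\rangle$; $\psi_\mu(x^2)=\mu(x^2)$, $\psi_\mu(y)=1$. $G_3=\langle x, y, z : x^4=y^2=z^2=1,\ [x, z]=[y,z]=1,\ [x, y]=x^2\rangle$; $Z(G)=\langle x^2,z\rangle$, $G'=\langle x^2\rangle$; $H=\langle x^2,y,z\rangle$; $\psi_\mu(x^2)=\mu(x^2)$, $\psi_\mu(y)=1$, $\psi_\mu(z)=\mu(z)$. $G_4=\langle x, y, z : x^4=y^2=z^2=1,\ [x, z]=[y,z]=1,\ [x, y]=z\rangle$; $Z(G)=\langle x^2,z\rangle$, $G'=\langle z\rangle$; $H=\langle x^2,y,z\rangle$; $\psi_\mu(x^2)=\mu(x^2)$, $\psi_\mu(y)=1$, $\psi_\mu(z)=\mu(z)$. $G_5=\langle x, y :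 x^4=y^4=1,\ [x, y]=x^2\rangle$; $Z(G)=\langle x^2,y^2\rangle$, $G'=\langle x^2\rangle$; $H=\langle x^2,y\rangle$; $\psi_\mu(x^2)=\mu(x^2)$, $\psi_\mu(y)=(\mu(y^2))^{1/2}$. $G_6=\langle x, y, z : x^4=y^4=z^2=1,\ [x, z]=[y,z]=1,\ [x, y]=x^2,\ x^2=y^2\rangle$; $Z(G)=\langle x^2,z\rangle$, $G'=\langle x^2\rangle$; $H=\langle x,z\rangle$; $\psi_\mu(x)=(\mu(x^2))^{1/2}$, $\psi_\mu(z)=\mu(z)$. Then in each case $(H,\psi_\mu)$ is a special required pair for an irreducible rational matrix representation of $G$ affording $\Omega(\chi_\mu)$. Consequently these pairs determine all inequivalent irreducible rational matrix representations of $G$ whose kernels do not contain $G'$: every such representation is equivalent to $\Psi_\mu^G$ for some $\mu\in\mathrm{Irr}(Z(G)\mid G')$, where $\Psi_\mu$ is an irreducible $\mathbb{Q}$-representation of $H$ affording $\Omega(\psi_\mu)$, and $\Psi_\mu^G$ affords $\Omega(\chi_\mu)$.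
   Context: The list $G_1,\dots,G_6$ (taken from Burnside) contains all groups of order $16$ of nilpotency class $2$ up to isomorphism. For such $G$, $\mathrm{Irr}(Z(G)\mid G')=\{\mu\in\mathrm{Irr}(Z(G)) : G'\not\subseteq\ker\mu\}$, and the non-linear irreducible complex characters of $G$ are exactly the $\chi_\mu$, $\mu\in\mathrm{Irr}(Z(G)\mid G')$, with $\chi_\mu(g)=2\mu(g)$ for $g\in Z(G)$ and $\chi_\mu(g)=0$ otherwise. For an irreducible complex character $\chi$, $\Omega(\chi)=m_{\mathbb{Q}}(\chi)\sum_{\sigma\in\mathrm{Gal}(\mathbb{Q}(\chi)/\mathbb{Q})}\chi^\sigma$, where $m_{\mathbb{Q}}(\chi)$ is the Schur index over $\mathbb{Q}$ and $\mathbb{Q}(\chi)$ is the field of character values; it is the character of an irreducible $\mathbb{Q}$-representation. For $\chi\in\mathrm{Irr}(G)$ a special required pair for an irreducible rational matrix representation affording $\Omega(\chi)$ is a pair $(H,\psi)$ with $H\le G$ and $\psi$ a linear character of $H$ such that $\psi^G=\chi$ and: $\mathbb{Q}(\psi)=\mathbb{Q}(\chi)$ if $m_{\mathbb{Q}}(\chi)=1$; $[\mathbb{Q}(\psi):\mathbb{Q}(\chi)]=2$ if $m_{\mathbb{Q}}(\chi)=2$. $\psi^G$, $\Psi^G$ denote induction to $G$. *)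

(* Defs.v *)
(* Complex characters are taken with values in algC, as in character.v. *)
From mathcomp Require Import all_boot all_order all_algebra.
From mathcomp Require Import all_fingroup all_solvable all_field all_character.
From mathcomp.classical Require classical_sets.

Set Implicit Arguments.
Unset Strict Implicit.
Unset Printing Implicit Defensive.

Import GroupScope Order.TTheory GRing.Theory Num.Theory.
Local Open Scope ring_scope.

Section InducedRepresentation.

Variables (F : fieldType) (gT : finGroupType) (G H : {group gT}).
Variables (sHG : H \subset G) (n : nat) (rH : mx_representation F H n).

Definition coset_rep (i : 'I_#|G : H|) : gT :=
  repr (enum_val i : {set gT}).

Definition ind_block (g : gT) : 'M[F]_n := if g \in H then rH g else 0.

(* Representations act on row vectors, so the induced module is the direct sum
   of the V (x) t_i for a right transversal (t_i), where
   (v (x) t_i) g = v (t_i g t_j^-1) (x) t_j as soon as t_i g t_j^-1 \in H. *)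
Definition ind_mx (g : gT) : 'M[F]_(\sum_(i < #|G : H|) n) :=
  \mxblock_(i < #|G : H|, j < #|G : H|)
     ind_block (coset_rep i * g * (coset_rep j)^-1)%g.

Lemma coset_repE i : enum_val i = (H :* coset_rep i)%g.
Proof.
have /rcosetsP[x _ Ex] := enum_valP i.
by rewrite /coset_rep Ex rcoset_repr.
Qed.

Lemma coset_repG i : coset_rep i \in G.
Proof.
have /rcosetsP[x Gx Ex] := enum_valP i; rewrite /coset_rep Ex.
have: repr (H :* x)%g \in (H :* x)%g by rewrite mem_repr_rcoset.
by apply: subsetP; rewrite mul_subG ?sub1set.
Qed.

Lemma coset_rep_uniq i j :
  (coset_rep i * (coset_rep j)^-1 \in H)%g = (i == j).
Proof.
rewrite -mem_rcoset -(inj_eq enum_val_inj) !coset_repE.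
by apply/rcoset_eqP/eqP.
Qed.

Lemma coset_rep_ex g : g \in G -> {i | (g * (coset_rep i)^-1 \in H)%g}.
Proof.
move=> Gg; have Hg: (H :* g)%g \in rcosets H G by rewrite mem_rcosets mulSGid.
exists (enum_rank_in Hg (H :* g)%g); rewrite -mem_rcoset -coset_repE.
by rewrite enum_rankK_in // rcoset_refl.
Qed.

Lemma ind_mx_repr : mx_repr G ind_mx.
Proof.
split=> [|x y Gx Gy].
  rewrite -mxdiagZ /mxdiag; apply: eq_mxblock => i j.
  rewrite mulg1 conform_mx_id /ind_block coset_rep_uniq.
  by case: eqP => // ->; rewrite mulgV repr_mx1.
rewrite mul_mxblock; apply: eq_mxblock => i j.
have [k Hk] := coset_rep_ex (groupM (coset_repG i) Gx).
rewrite (bigD1 k) //= big1 ?addr0 => [|l /negPf lk]; last first.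
  rewrite {1}/ind_block ifN ?mul0mx //; apply: contraFN lk => Hl.
  rewrite eq_sym -coset_rep_uniq.
  have := groupM (groupVr Hk) Hl; set a := (coset_rep i * x)%g.
  by rewrite invMg invgK -mulgA mulKg.
have -> : (coset_rep i * (x * y) * (coset_rep j)^-1 =
    coset_rep i * x * (coset_rep k)^-1 *
      (coset_rep k * y * (coset_rep j)^-1))%g.
  by rewrite !mulgA mulgKV.
rewrite /ind_block groupMl // Hk; case: ifP => Hky; last by rewrite mulmx0.
by rewrite repr_mxM.
Qed.

Definition ind_repr := MxRepresentation ind_mx_repr.

End InducedRepresentation.

Definition rat_char (gT : finGroupType) (G : {group gT}) (n : nat)
    (rG : mx_representation rat G n) : 'CF(G) :=
  cfRepr (map_repr (@ratr algC) rG).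

(* Schur index over the rationals: the multiplicity of chi in (the scalar
   extension of) an irreducible rational representation that has chi as a
   constituent. Such a representation exists and is unique up to similarity when
   chi is irreducible, so the choice made by xget is immaterial. *)
Definition schur_index (gT : finGroupType) (G : {group gT}) (chi : 'CF(G)) :
    nat :=
  classical_sets.xget 0%N (fun m : nat => (0 < m)%N /\
    exists n (rG : mx_representation rat G n),
      mx_irreducible rG /\ '[rat_char rG, chi] = m%:R).

Section CharacterFields.

Variables (gT : finGroupType) (G : {group gT}).

(* The cyclotomic field generated by the #|G|-th roots of unity, with an
   embedding in algC: it contains the values of the characters of all the
   subgroups of G, so that fields of character values are subfields of it. *)
Definition cyclo_field : splittingFieldType rat :=
  tag2 (group_num_field_exists G).

Definition cyclo_embed : {rmorphism cyclo_field -> algC} :=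
  tag2 (tagged2' (group_num_field_exists G)).

Definition cyclo_lift (a : algC) : cyclo_field :=
  classical_sets.xget 0 (fun b => cyclo_embed b = a).

(* Q(phi), for a class function phi of a subgroup H of G. *)
Definition char_field (H : {group gT}) (phi : 'CF(H)) :
    {subfield cyclo_field} :=
  <<1 & [seq cyclo_lift (phi h) | h in H]>>%AS.

Definition galois_conj_fun (E : {subfield cyclo_field}) (s : gal_of E)
    (a : algC) : algC := cyclo_embed (s (cyclo_lift a)).

Fact galois_conj_fun0 (E : {subfield cyclo_field}) (s : gal_of E) : galois_conj_fun s 0 = 0.
Proof.
rewrite /galois_conj_fun /cyclo_lift; case: classical_sets.xgetP => [b _ /eqP|].
  by rewrite fmorph_eq0 => /eqP->; rewrite !rmorph0.
by move/(_ 0); rewrite rmorph0; case.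
Qed.

Definition galois_conj (E : {subfield cyclo_field}) (s : gal_of E)
    (H : {group gT}) (phi : 'CF(H)) : 'CF(H) :=
  cfun_comp (galois_conj_fun0 s) phi.

End CharacterFields.

Definition Omega (gT : finGroupType) (G : {group gT}) (chi : 'CF(G)) : 'CF(G) :=
  (\sum_(s in 'Gal(char_field G chi / 1%AS)) galois_conj s chi)
    *+ schur_index chi.

(* All the field extensions below live in cyclo_field G. *)
Definition special_required_pair (gT : finGroupType) (G H : {group gT})
    (chi : 'CF(G)) (psi : 'CF(H)) : Prop :=
  [/\ [/\ chi \in irr G, H \subset G & psi \is a linear_char],
      'Ind[G] psi = chi,
      schur_index chi = 1%N -> char_field G psi = char_field G chi
    & schur_index chi = 2%N ->
        (char_field G chi <= char_field G psi)%VS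
        /\ \dim_(char_field G chi) (char_field G psi) = 2%N].

(* Usually written Irr(Z | N). *)
Definition irr_over (gT : finGroupType) (Z : {group gT}) (N : {set gT}) :
    {pred 'CF(Z)} :=
  [pred mu : 'CF(Z) | (mu \in irr Z) && ~~ (N \subset cfker mu)].
Arguments irr_over {gT} Z%_G N%_g.

Section CentralCharacters.

Variables (gT : finGroupType) (G : {group gT}) (mu : 'CF('Z(G))).

Fact central_char_subproof :
  is_class_fun <<G>> [ffun g => if g \in 'Z(G) then 2%:R * mu g else 0].
Proof.
rewrite genGid; apply: intro_class_fun => [g h Gg Gh | g notGg].
  rewrite memJ_norm ?(subsetP (normal_norm (center_normal G))) //.
  case: ifP => // Zg; have /centerP[_ /(_ h Gh) cgh] := Zg.
  by rewrite conjgE cgh mulKg.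
by rewrite ifN //; apply: contra notGg; apply: (subsetP (center_sub G)).
Qed.

(* chi_mu; when #|G| = 16 and G has class 2 these are, for mu in
   irr_over 'Z(G) G^`(1), the non-linear irreducible characters of G. *)
Definition central_char : 'CF(G) := Cfun 0 central_char_subproof.

End CentralCharacters.

(* The pairs (H, psi), for mu in Irr(Z(G) | G') and psi the linear character of
   H described by psi_spec mu, are well defined, are special required pairs, and
   determine the irreducible rational representations of G whose kernel does not
   contain G'. *)
Definition rational_reprs_from_pairs (gT : finGroupType) (G H : {group gT})
    (psi_spec : 'CF('Z(G)) -> 'CF(H) -> Prop) : Prop :=
  exists sHG : H \subset G,
  [/\ forall mu, mu \in irr_over 'Z(G) G^`(1)%g ->
        exists! psi : 'CF(H), psi \is a linear_char /\ psi_spec mu psi,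
      forall mu (psi : 'CF(H)), mu \in irr_over 'Z(G) G^`(1)%g ->
        psi \is a linear_char -> psi_spec mu psi ->
        [/\ special_required_pair (central_char mu) psi,
            exists n (Psi : mx_representation rat H n),
              mx_irreducible Psi /\ rat_char Psi = Omega psi
          & forall n (Psi : mx_representation rat H n),
              mx_irreducible Psi -> rat_char Psi = Omega psi ->
              [/\ mx_irreducible (ind_repr sHG Psi),
                  rat_char (ind_repr sHG Psi) = Omega (central_char mu)
                & ~~ (G^`(1)%g \subset rker (ind_repr sHG Psi))]]
    & forall n (rG : mx_representation rat G n),
        mx_irreducible rG -> ~~ (G^`(1)%g \subset rker rG) ->
        exists mu (psi : 'CF(H)) m (Psi : mx_representation rat H m),
          [/\ mu \in irr_over 'Z(G) G^`(1)%g,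
              psi \is a linear_char /\ psi_spec mu psi,
              mx_irreducible Psi /\ rat_char Psi = Omega psi
            & mx_rsim rG (ind_repr sHG Psi)]].

(* In presented_i G x .., G is isomorphic to the group with the i-th
   presentation, and x, .. are generators of G that satisfy the relations, hence
   correspond to the generators of the presentation (G being finite). *)
Section Presentations.

Local Open Scope group_scope.
Variables (gT : finGroupType) (G : {group gT}).

Definition presented_1 (x y z : gT) : Prop :=
  [/\ G \isog Grp (x : y : z : x ^+ 4, y ^+ 2, z ^+ 2,
        [~ x, y], [~ x, z], [~ y, z] = x ^+ 2),
      <<[set x; y; z]>> = G,
      [/\ x ^+ 4 = 1, y ^+ 2 = 1 & z ^+ 2 = 1]
    & [/\ [~ x, y] = 1, [~ x, z] = 1 & [~ y, z] = x ^+ 2]].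

Definition presented_2 (x y : gT) : Prop :=
  [/\ G \isog Grp (x : y : x ^+ 8, y ^+ 2, [~ x, y] = x ^+ 4),
      <<[set x; y]>> = G,
      x ^+ 8 = 1 /\ y ^+ 2 = 1
    & [~ x, y] = x ^+ 4].

Definition presented_3 (x y z : gT) : Prop :=
  [/\ G \isog Grp (x : y : z : x ^+ 4, y ^+ 2, z ^+ 2,
        [~ x, z], [~ y, z], [~ x, y] = x ^+ 2),
      <<[set x; y; z]>> = G,
      [/\ x ^+ 4 = 1, y ^+ 2 = 1 & z ^+ 2 = 1]
    & [/\ [~ x, z] = 1, [~ y, z] = 1 & [~ x, y] = x ^+ 2]].

Definition presented_4 (x y z : gT) : Prop :=
  [/\ G \isog Grp (x : y : z : x ^+ 4, y ^+ 2, z ^+ 2,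
        [~ x, z], [~ y, z], [~ x, y] = z),
      <<[set x; y; z]>> = G,
      [/\ x ^+ 4 = 1, y ^+ 2 = 1 & z ^+ 2 = 1]
    & [/\ [~ x, z] = 1, [~ y, z] = 1 & [~ x, y] = z]].

Definition presented_5 (x y : gT) : Prop :=
  [/\ G \isog Grp (x : y : x ^+ 4, y ^+ 4, [~ x, y] = x ^+ 2),
      <<[set x; y]>> = G,
      x ^+ 4 = 1 /\ y ^+ 4 = 1
    & [~ x, y] = x ^+ 2].

Definition presented_6 (x y z : gT) : Prop :=
  [/\ G \isog Grp (x : y : z : x ^+ 4, y ^+ 4, z ^+ 2,
        [~ x, z], [~ y, z], [~ x, y] = x ^+ 2, x ^+ 2 = y ^+ 2),
      <<[set x; y; z]>> = G,
      [/\ x ^+ 4 = 1, y ^+ 4 = 1 & z ^+ 2 = 1]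
    & [/\ [~ x, z] = 1, [~ y, z] = 1, [~ x, y] = x ^+ 2 & x ^+ 2 = y ^+ 2]].

End Presentations.

(* Main.v *)
Require Import Defs.
From mathcomp Require Import all_boot all_order all_algebra.
From mathcomp Require Import all_fingroup all_solvable all_field all_character.
From mathcomp Require Import ring.
From mathcomp.classical Require classical_sets.

Set Implicit Arguments.
Unset Strict Implicit.
Unset Printing Implicit Defensive.

Import GroupScope Order.TTheory GRing.Theory Num.Theory.
Local Open Scope ring_scope.

(** Each of the six groups is generated by its center Z, of order 4, and two
    elements a and b with central squares, and its derived subgroup is
    generated by the central involution e = [a, b]
    ([rational_reprs_two_generators]). In every case H = <Z, b>, an abelian
    subgroup of index 2 in G, and psi is an extension of mu to H, determined by
    a square root psi b of mu (b ^ 2).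

    Since G' is not in the kernel of mu, mu e = -1. An element g outside Z has
    a conjugate g e, so psi takes opposite values on the H-elements g and g e,
    and 'Ind psi vanishes outside Z; on Z it is 2 mu, hence it is the class
    function chi_mu ([Ind_central_char]), and it has norm 1 because #|G : Z| =
    4. The same computation, applied to a constituent of a restriction to H,
    shows that these are all the irreducible characters whose kernel does not
    contain G' ([nonlinear_central_char]).

    H has exponent dividing 4, so psi and chi_mu have values in Q(i), and a
    character phi with such values has Galois conjugates phi and phi^* only:
    the sum of its conjugates is phi if phi is real, and phi + phi^* otherwise
    ([sum_galois_conj_real], [sum_galois_conj_nonreal]). Letting i act as a
    matrix of square -1, one gets a rational representation Psi of H that
    affords this sum for psi ([conj_sum_afforded]). The induced representation
    affords 'Ind psi + ('Ind psi)^*, or 'Ind psi if psi is real, and there are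
    two cases.
    - If psi and chi_mu are both real or both nonreal, this is the sum of the
      conjugates of chi_mu, each taken once. A summand of a rational
      representation contains conjugate characters with the same multiplicity,
      so Psi^G is irreducible, and the Schur index of chi_mu is 1.
    - If chi_mu is real but psi is not, then Psi^G affords 2 chi_mu. This
      requires psi b to be nonreal, that is mu (b ^ 2) = -1, and then (in the
      last two groups) a ^ 2 = e, so mu (a ^ 2) = -1 as well: a and b act as
      the quaternion units of a 2-dimensional representation that affords
      chi_mu. Two rational 2 x 2 matrices cannot satisfy the quaternion
      relations ([no_rational_quaternion_mx]), so chi_mu is not afforded over
      the rationals, Psi^G is irreducible, and the Schur index is 2, the degree
      of Q(psi) = Q(i) over Q(chi_mu) = Q.

    Finally irreducible rational representations that share a complex
    constituent are similar ([rat_irr_rsim_constt]). This makes the Schur index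
    well defined, and it identifies any irreducible rational representation
    with a constituent chi_mu with the corresponding Psi^G. *)

(** * Characters of rational representations *)

Section RationalRepresentations.

Variables (gT : finGroupType) (G : {group gT}).

Lemma rat_charE n (rG : mx_representation rat G n) g :
  g \in G -> rat_char rG g = ratr (\tr (rG g)).
Proof. by move=> Gg; rewrite /rat_char cfunE Gg mulr1n /= trace_map_mx. Qed.

Lemma rat_char1 n (rG : mx_representation rat G n) : rat_char rG 1%g = n%:R.
Proof. by rewrite /rat_char cfRepr1. Qed.

Lemma rat_char_char n (rG : mx_representation rat G n) :
  rat_char rG \is a character.
Proof. exact: cfRepr_char. Qed.

Lemma rat_char_aut (nu : {rmorphism algC -> algC}) n
    (rG : mx_representation rat G n) :
  cfAut nu (rat_char rG) = rat_char rG.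
Proof. by apply/cfun_inP => g Gg; rewrite cfunE rat_charE // fmorph_rat. Qed.

Lemma cfker_rat_char n (rG : mx_representation rat G n) :
  cfker (rat_char rG) = rker rG.
Proof. by rewrite cfker_repr rker_map. Qed.

Lemma rat_char_rsim n1 n2 (r1 : mx_representation rat G n1)
    (r2 : mx_representation rat G n2) :
  mx_rsim r1 r2 -> rat_char r1 = rat_char r2.
Proof.
by move=> sim; apply/cfun_inP => g Gg; rewrite !rat_charE // (mxtrace_rsim sim).
Qed.

(** Maschke's theorem turns a proper submodule into a decomposition of the
    character, so irreducibility can be tested on characters. *)
Lemma rat_char_irreducible n (rG : mx_representation rat G n) :
    (0 < n)%N ->
    (forall n1 n2 (r1 : mx_representation rat G n1)
        (r2 : mx_representation rat G n2),
      rat_char rG = rat_char r1 + rat_char r2 -> n1 = 0%N \/ n2 = 0%N) ->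
  mx_irreducible rG.
Proof.
move=> n_gt0 indec; apply/mx_irrP; split=> // U modU nzU.
have charG : [pchar rat]^'.-group G.
  by apply/pgroupP => p _ _; rewrite inE /= pchar_num.
have [V modV defUV dxUV] := mx_Maschke_pchar rG charG modU (submx1 U).
have: rat_char rG = rat_char (submod_repr modU) + rat_char (submod_repr modV).
  apply/cfun_inP => g Gg; rewrite [RHS]cfunE !rat_charE // -rmorphD /=.
  rewrite (mxtrace_dadd_mod modU modV (mxmodule1 rG)) //.
  by rewrite mxtrace_submod1.
case/indec => /eqP; first by rewrite mxrank_eq0 (negPf nzU).
rewrite mxrank_eq0 -sub1mx -defUV addsmx_sub submx_refl /= => /eqP->.
by rewrite sub0mx.
Qed.

Section Intertwiners.

Variables (n1 n2 : nat) (r1 : mx_representation rat G n1).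
Variable (r2 : mx_representation rat G n2).

Definition average_mx (M : 'M[rat]_(n1, n2)) : 'M[rat]_(n1, n2) :=
  \sum_(x in G) r1 x *m M *m r2 x^-1%g.

Lemma average_mx_hom M y :
  y \in G -> r1 y *m average_mx M = average_mx M *m r2 y.
Proof.
move=> Gy; rewrite mulmx_sumr mulmx_suml.
rewrite [RHS](reindex_inj (mulgI y)); apply: eq_big => x /=.
  by rewrite groupMl.
move=> Gx; rewrite invMg !repr_mxM ?groupV // -!mulmxA.
by rewrite -(repr_mxM r2 (groupVr Gy) Gy) mulVg repr_mx1 mulmx1.
Qed.

(** Schur's lemma: kernel and image of an intertwiner are submodules. *)
Lemma irr_hom_rsim f :
    mx_irreducible r1 -> mx_irreducible r2 ->
    (forall x, x \in G -> r1 x *m f = f *m r2 x) -> f != 0 ->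
  mx_rsim r1 r2.
Proof.
move=> /mx_irrP[_ irr1] /mx_irrP[_ irr2] homf nzf.
have freef : row_free f.
  rewrite -kermx_eq0; apply: contraNT nzf => nz_ker.
  have modK : mxmodule r1 (kermx f).
    apply/mxmoduleP => x Gx; apply/sub_kermxP.
    by rewrite -mulmxA homf // mulmxA mulmx_ker mul0mx.
  by rewrite -[f]mul1mx; apply/eqP/sub_kermxP; rewrite sub1mx irr1.
have fullf : row_full f.
  have: row_full <<f>>%MS.
    apply: irr2; last by rewrite -mxrank_eq0 genmxE mxrank_eq0.
    apply/mxmoduleP => x Gx; rewrite (eqmxMr _ (genmxE f)) genmxE -homf //.
    exact: submxMl.
  by rewrite /row_full genmxE.
apply: (MxReprSim _ freef homf).
by rewrite -(eqP freef) (eqP fullf).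
Qed.

Lemma cfdot_rat_char :
  '[rat_char r1, rat_char r2] =
     #|G|%:R^-1 * ratr (\sum_i \sum_j average_mx (delta_mx i j) i j).
Proof.
rewrite cfdotE; congr (_ * _).
have avgE i j :
    average_mx (delta_mx i j) i j = \sum_(x in G) r1 x i i * r2 x^-1%g j j.
  rewrite summxE; apply: eq_bigr => x _.
  rewrite mxE (bigD1 j) //= big1 ?addr0 => [|k kj]; last first.
    rewrite mxE big1 ?mul0r // => l _.
    by rewrite mxE (negPf kj) andbF mulr0.
  congr (_ * _); rewrite mxE (bigD1 i) //= big1 ?addr0 => [|l li].
    by rewrite mxE !eqxx mulr1.
  by rewrite mxE (negPf li) mulr0.
under [in RHS]eq_bigr do under eq_bigr do rewrite avgE.
under [in RHS]eq_bigr do rewrite exchange_big /=.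
rewrite exchange_big /= rmorph_sum; apply: eq_bigr => x Gx.
rewrite -(char_inv _ (rat_char_char r2)) !rat_charE ?groupV // -rmorphM.
congr (ratr _); rewrite /mxtrace mulr_suml; apply: eq_bigr => i _.
by rewrite mulr_sumr.
Qed.

(** If the two characters are not orthogonal, averaging some elementary matrix
    gives a nonzero intertwiner. *)
Lemma rat_irr_rsim :
    mx_irreducible r1 -> mx_irreducible r2 ->
    '[rat_char r1, rat_char r2] != 0 ->
  mx_rsim r1 r2.
Proof.
move=> irr1 irr2; rewrite cfdot_rat_char => nz.
have [[i j] nzf] : exists ij, average_mx (delta_mx ij.1 ij.2) != 0.
  apply/existsP; apply: contraNT nz; rewrite negb_exists => /forallP z.
  rewrite big1 ?rmorph0 ?mulr0 // => i _; rewrite big1 // => j _.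
  by have := z (i, j); rewrite negbK => /eqP->; rewrite mxE.
exact: (irr_hom_rsim irr1 irr2 (@average_mx_hom _) nzf).
Qed.

End Intertwiners.

(** Multiplicities of complex constituents are nonnegative, so a common one keeps
    the characters from being orthogonal. *)
Lemma rat_irr_rsim_constt n1 n2 (r1 : mx_representation rat G n1)
    (r2 : mx_representation rat G n2) chi :
    mx_irreducible r1 -> mx_irreducible r2 -> chi \in irr G ->
    '[rat_char r1, chi] != 0 -> '[rat_char r2, chi] != 0 ->
  mx_rsim r1 r2.
Proof.
move=> irr1 irr2 /irrP[i ->] c1 c2; apply: rat_irr_rsim => //.
have [N1 N2] := (rat_char_char r1, rat_char_char r2).
apply: contraNneq c1 => z; move: z; rewrite cfdot_sum_irr.
have real2 j : ('[rat_char r2, 'chi_j])^* = '[rat_char r2, 'chi_j].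
  by rewrite (conj_natr (Cnat_cfdot_char_irr j N2)).
have ge0 j : 0 <= '[rat_char r1, 'chi_j] * ('[rat_char r2, 'chi_j])^*.
  by rewrite real2 mulr_ge0 ?natr_ge0 ?Cnat_cfdot_char_irr.
move/(psumr_eq0P (fun j _ => ge0 j))/(_ i isT)/eqP.
by rewrite real2 mulf_eq0 (negPf c2) orbF.
Qed.

End RationalRepresentations.

(** Both sides sum the values of the character of [rH] over the conjugates of [g]:
    the trace over a transversal of [H], the induced class function over the
    whole of [G], where each coset of [H] repeats one value [#|H|] times. *)
Lemma rat_char_ind (gT : finGroupType) (G H : {group gT}) (sHG : H \subset G)
    n (rH : mx_representation rat H n) :
  rat_char (ind_repr sHG rH) = 'Ind[G] (rat_char rH).
Proof.
apply/cfun_inP => g Gg; rewrite rat_charE // cfIndE //=.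
have blockE x : ratr (\tr (ind_block rH x)) = rat_char rH x.
  rewrite /ind_block; have [Hx | notHx] := boolP (x \in H).
    by rewrite rat_charE.
  by rewrite mxtrace0 rmorph0 [RHS]cfun0.
rewrite mxtrace_mxblock rmorph_sum /= [in RHS](reindex_inj invg_inj) /=.
under [in RHS]eq_bigl do rewrite groupV.
rewrite (set_partition_big _ (rcosets_partition sHG)) big_enum_val /= mulr_sumr.
apply: eq_bigr => i _; rewrite blockE coset_repE.
set t := coset_rep i; have defHt y : (y \in H :* t)%g = (y * t^-1 \in H)%g.
  by rewrite mem_rcoset.
rewrite (eq_bigl _ _ defHt) (reindex_inj (mulIg t)) /=.
under eq_bigl do rewrite mulgK.
rewrite (eq_bigr (fun=> rat_char rH (t * g * t^-1)%g)) => [|h Hh].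
  by rewrite sumr_const -[X in _ * X]mulr_natl mulKf ?neq0CG.
rewrite -(cfunJ _ (t * g * t^-1)%g (groupVr Hh)).
by rewrite !conjgE !invMg !invgK !mulgA.
Qed.

(** * Characters with values in Q(i) *)

Definition gaussian (a : algC) := ('Re a \in Crat) && ('Im a \in Crat).

Lemma gaussianP a :
  reflect (exists p q : rat, a = ratr p + 'i * ratr q) (gaussian a).
Proof.
apply: (iffP andP) => [[/CratP[p Dp] /CratP[q Dq]] | [p [q ->]]].
  by exists p, q; rewrite -Dp -Dq -Crect.
have [Rp Rq] : ratr p \is Creal /\ ratr q \is Creal.
  by split; apply: Creal_Crat; apply: Crat_rat.
by rewrite Re_rect ?Im_rect // !Crat_rat.
Qed.

Lemma unity4_cases (a : algC) :
  a ^+ 4 = 1 -> [\/ a = 1, a = -1, a = 'i | a = -'i].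
Proof.
move=> a4; have/eqP: (a ^+ 2 - 1) * (a ^+ 2 + 1) = 0.
  by rewrite -subr_sqr -exprM a4 expr1n subrr.
rewrite mulf_eq0 subr_eq0 addr_eq0 sqrf_eq1 
  -[in X in _ || X](sqrCi algC) eqf_sqr.
by case/orP => /orP[] /eqP ->;
  [constructor 1 | constructor 2 | constructor 3 | constructor 4].
Qed.

Lemma unity4_gaussian (a : algC) : a ^+ 4 = 1 -> gaussian a.
Proof.
case/unity4_cases => ->; apply/gaussianP.
- by exists 1, 0; rewrite rmorph1 rmorph0 mulr0 addr0.
- by exists (-1), 0; rewrite rmorphN1 rmorph0 mulr0 addr0.
- by exists 0, 1; rewrite rmorph1 rmorph0 mulr1 add0r.
- by exists 0, (-1); rewrite rmorphN1 rmorph0 mulrN1 add0r.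
Qed.

Lemma gaussian0 : gaussian 0.
Proof. by rewrite /gaussian !raddf0 rpred0. Qed.

Lemma gaussian_natM n a : gaussian a -> gaussian (n%:R * a).
Proof.
case/gaussianP => p [q ->]; apply/gaussianP; exists (n%:R * p), (n%:R * q).
by rewrite !rmorphM !rmorph_nat mulrDr; congr (_ + _); rewrite mulrCA.
Qed.

Lemma gaussian_real a : gaussian a -> a^* = a -> a \in Crat.
Proof.
by case/andP => ratRe _ /CrealP/Creal_ReP a_eq; rewrite -a_eq.
Qed.

Section CyclotomicValues.

Variables (gT : finGroupType) (G : {group gT}).

Lemma cyclo_embedK : cancel (cyclo_embed G) (cyclo_lift G).
Proof.
move=> b; rewrite /cyclo_lift; apply: classical_sets.xget_unique => // c.
by move/fmorph_inj.
Qed.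

Lemma galois_conj_funE (E : {subfield cyclo_field G}) (s : gal_of E) b :
  galois_conj_fun s (cyclo_embed G b) = cyclo_embed G (s b).
Proof. by rewrite /galois_conj_fun cyclo_embedK. Qed.

Lemma cyclo_embed_rat p : cyclo_embed G (ratr p) = ratr p.
Proof. exact: fmorph_rat. Qed.

Lemma rat_in_subfield (E : {subfield cyclo_field G}) p : ratr p \in E.
Proof. by rewrite -alg_num_field rpredZ ?mem1v. Qed.

Variables (H : {group gT}) (phi : 'CF(H)).
Hypotheses (sHG : H \subset G) (Nphi : phi \is a character).
Hypothesis gaussphi : forall g, gaussian (phi g).

Lemma cyclo_liftK x : cyclo_embed G (cyclo_lift G (phi x)) = phi x.
Proof.
have [Hx | notHx] := boolP (x \in H); last first.
  by rewrite cfun0 // -(rmorph0 (cyclo_embed G)) cyclo_embedK.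
have valG := tagged2' (tagged2' (tagged2' (group_num_field_exists G))).
have [b Db] := valG _ _ _ Nphi x (order_dvdG (subsetP sHG _ Hx)).
by rewrite -Db cyclo_embedK.
Qed.

Lemma char_field_sub (E : {subfield cyclo_field G}) :
  (forall h, h \in H -> cyclo_lift G (phi h) \in E) ->
  (char_field G phi <= E)%VS.
Proof.
move=> valE; apply/Fadjoin_seqP; split; first exact: sub1v.
by move=> _ /imageP[h Hh ->]; apply: valE.
Qed.

Lemma mem_char_field h : h \in H -> cyclo_lift G (phi h) \in char_field G phi.
Proof. by move=> Hh; apply: seqv_sub_adjoin; apply: image_f. Qed.

Lemma char_field_real : cfReal phi -> char_field G phi = 1%AS.
Proof.
move=> Rphi; apply: val_inj => /=; apply/eqP; rewrite eqEsubv sub1v andbT.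
apply: (@char_field_sub 1%AS) => h Hh.
have /CratP[p Dp] : phi h \in Crat.
  by apply: gaussian_real => //; rewrite -[in RHS](eqP Rphi) cfunE.
by rewrite Dp -cyclo_embed_rat cyclo_embedK rat_in_subfield.
Qed.

Lemma galois_conj_rect (E : {subfield cyclo_field G}) (s : gal_of E) b h p q :
    phi h = ratr p + cyclo_embed G b * ratr q ->
  galois_conj s phi h = ratr p + cyclo_embed G (s b) * ratr q.
Proof.
move=> Dphi; rewrite cfunE Dphi -!cyclo_embed_rat.
rewrite -(rmorphM _ b) -(rmorphD _ (ratr p)) galois_conj_funE.
rewrite (rmorphD s (ratr p)) (rmorphM s b) !fmorph_rat.
by rewrite (rmorphD _ (ratr p)) (rmorphM _ (s b)) /= !fmorph_rat.
Qed.

Lemma sum_galois_conj_real :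
    cfReal phi ->
  \sum_(s in 'Gal(char_field G phi / 1%AS)) galois_conj s phi = phi.
Proof.
move=> Rphi; rewrite (char_field_real Rphi).
have -> : 'Gal(1%AS / 1%AS) = 1%g
    :> {set gal_of (1%AS : {subfield cyclo_field G})}.
  apply/trivgP/subsetP => s Gs; rewrite inE; apply/gal_eqP => b F_b.
  by rewrite gal_id (fixed_gal (subvv _) Gs).
rewrite big_set1; apply/cfunP => h.
by rewrite cfunE -{1}cyclo_liftK galois_conj_funE gal_id cyclo_liftK.
Qed.

Section NonReal.

Hypothesis nonreal_phi : ~~ cfReal phi.

Let iota := cyclo_lift G 'i.

(** A nonreal value p + q i in Q(i), with q != 0, gives back i. *)
Lemma imaginary_in_char_field :
  cyclo_embed G iota = 'i /\ iota \in char_field G phi.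
Proof.
have [h Hh nonreal_h] : exists2 h, h \in H & (phi h)^* != phi h.
  apply/exists_inP; apply: contraR nonreal_phi.
  rewrite negb_exists_in => /forall_inP real_phi.
  by apply/eqP/cfun_inP => h /real_phi; rewrite cfunE negbK => /eqP.
have /gaussianP[p [q Dphi]] := gaussphi h.
have nz_q : q != 0.
  apply: contraNneq nonreal_h => q0.
  by rewrite Dphi q0 rmorph0 mulr0 addr0 conj_Crat ?Crat_rat.
pose c := (cyclo_lift G (phi h) - ratr p) / ratr q.
have Dc : cyclo_embed G c = 'i.
  rewrite fmorph_div rmorphB /= cyclo_liftK !cyclo_embed_rat Dphi addrC addKr.
  by rewrite mulfK // fmorph_eq0.
have -> : iota = c by rewrite /iota -Dc cyclo_embedK.
by split=> //; rewrite rpred_div ?rpredB ?rat_in_subfield ?mem_char_field.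
Qed.

Lemma imaginary_sqr : iota ^+ 2 = -1.
Proof.
apply: (fmorph_inj (cyclo_embed G)).
have [Di _] := imaginary_in_char_field.
by rewrite rmorphXn /= Di sqrCi rmorphN1.
Qed.

Lemma imaginary_irrational : iota \notin 1%VS.
Proof.
apply/negP => /vlineP[p Dp]; have [Di _] := imaginary_in_char_field.
have: ('i : algC) \is Num.real.
  by rewrite -Di Dp alg_num_field cyclo_embed_rat Creal_Crat ?Crat_rat.
by rewrite CrealE conjCi eq_sym -addr_eq0 -mulr2n mulrn_eq0 (negPf (neq0Ci _)).
Qed.

Lemma char_field_nonreal : char_field G phi = <<1; iota>>%AS.
Proof.
have [Di iotaE] := imaginary_in_char_field.
apply: val_inj => /=; apply/eqP; rewrite eqEsubv; apply/andP; split.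
  apply: (@char_field_sub <<1; iota>>%AS) => h _.
  have /gaussianP[p [q Dphi]] := gaussphi h.
  rewrite Dphi -Di -!cyclo_embed_rat -rmorphM -rmorphD cyclo_embedK.
  by apply: rpredD; last apply: rpredM; rewrite ?memv_adjoin ?rat_in_subfield.
by apply/(FadjoinP (E := char_field G phi)); rewrite sub1v.
Qed.

Let iota_poly : {poly cyclo_field G} :=
  \prod_(z <- [:: iota; - iota]) ('X - z%:P).

Let iota_polyE : iota_poly = 'X^2 + 1.
Proof.
rewrite /iota_poly !big_cons big_nil mulr1 rmorphN opprK -subr_sqr.
by rewrite -rmorphXn imaginary_sqr rmorphN1 opprK.
Qed.

Let iota_polyOver : iota_poly \is a polyOver 1%VS.
Proof. by rewrite iota_polyE rpredD ?rpredX ?polyOverX ?rpred1. Qed.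

Lemma dim_char_field_nonreal : \dim (char_field G phi) = 2%N.
Proof.
rewrite char_field_nonreal dim_Fadjoin dimv1 muln1; apply/eqP.
rewrite eqn_leq -ltnS -size_minPoly; apply/andP; split.
  have <- : size iota_poly = 3%N by rewrite size_prod_XsubC.
  apply: dvdp_leq; first by rewrite monic_neq0 ?monic_prod_XsubC.
  by rewrite minPoly_dvdp // root_prod_XsubC mem_head.
have := adjoin_deg_eq1 1%AS iota; rewrite (negPf imaginary_irrational).
by rewrite /adjoin_degree eqSS ltnS lt0n => ->.
Qed.

Lemma galois_char_field_nonreal : galois 1%AS (char_field G phi).
Proof.
apply/splitting_galoisField; exists iota_poly; split=> //.
  rewrite separable_prod_XsubC /= inE andbT -addr_eq0 -mulr2n.
  have [Di _] := imaginary_in_char_field.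
  by rewrite -(fmorph_eq0 (cyclo_embed G)) rmorphMn /= Di mulrn_eq0
     (negPf (neq0Ci _)).
exists [:: iota; - iota]; first exact: eqpxx.
rewrite char_field_nonreal adjoin_cons adjoin_seq1.
by apply/Fadjoin_idP; rewrite rpredN memv_adjoin.
Qed.

(** The Galois group of Q(i) has order 2, so its two elements send i to i and
    to -i, and the imaginary parts of the two conjugates cancel, as they do in
    the sum of a value and its complex conjugate. *)
Lemma sum_galois_conj_nonreal :
  \sum_(s in 'Gal(char_field G phi / 1%AS)) galois_conj s phi = phi + phi^*%CF.
Proof.
have [Di _] := imaginary_in_char_field.
have := galois_dim galois_char_field_nonreal.
rewrite dimv1 divn1 dim_char_field_nonreal char_field_nonreal.
move=> /esym/eqP/cards2P[s [t [neq_st Gal_st]]].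
have [Gs Gt] : s \in 'Gal(<<1; iota>> / 1%AS) /\ t \in 'Gal(<<1; iota>> / 1%AS).
  by rewrite Gal_st !inE !eqxx orbT.
have conj_iota (r : gal_of <<1; iota>>%AS) : r iota = iota \/ r iota = - iota.
  apply/pred2P; rewrite -eqf_sqr -rmorphXn imaginary_sqr.
  by rewrite rmorphN1.
have sum_iota : s iota + t iota = 0.
  move: neq_st; rewrite (gal_adjoin_eq Gs Gt).
  case: (conj_iota s) (conj_iota t) => -> [] ->; rewrite ?eqxx // ?subrr //.
  by rewrite addNr.
rewrite Gal_st big_setU1 ?inE // big_set1; apply/cfunP => h.
have /gaussianP[p [q Dphi]] := gaussphi h.
have conj_phi : (phi^*)%CF h = ratr p - 'i * ratr q.
  rewrite cfunE Dphi (rmorphD _ (ratr p)) (rmorphM _ 'i) !fmorph_rat /=.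
  by rewrite conjCi mulNr.
rewrite -Di in Dphi; rewrite [LHS]cfunE [RHS]cfunE conj_phi.
rewrite !(galois_conj_rect _ Dphi) Dphi Di addrACA.
rewrite -[X in _ + X = _]mulrDl -(rmorphD _ (s iota)) sum_iota.
by rewrite rmorph0 mul0r [RHS]addrACA subrr.
Qed.

End NonReal.

End CyclotomicValues.

(** * Schur index and irreducibility over the rationals *)

Section SchurIndex.

Variables (gT : finGroupType) (G : {group gT}).
Implicit Types chi phi : 'CF(G).

(** When [phi] has values in Q(i), the sum of its Galois conjugates. *)
Definition conj_sum (H : {group gT}) (phi : 'CF(H)) : 'CF(H) :=
  if cfReal phi then phi else phi + phi^*%CF.

Lemma Omega_gaussian chi :
    chi \is a character -> (forall g, gaussian (chi g)) ->
  Omega chi = conj_sum chi *+ schur_index chi.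
Proof.
move=> Nchi gauss_chi; rewrite /Omega /conj_sum.
case: ifP => [real_chi | /negbT nonreal_chi].
  by rewrite sum_galois_conj_real.
by rewrite sum_galois_conj_nonreal.
Qed.

(** The multiplicity does not depend on the representation, because those that
    have [chi] as a constituent are all similar. *)
Lemma schur_indexE n (rG : mx_representation rat G n) chi m :
    chi \in irr G -> mx_irreducible rG -> (0 < m)%N ->
    '[rat_char rG, chi] = m%:R ->
  schur_index chi = m.
Proof.
move=> irr_chi irr_rG m_gt0 Dm; apply: classical_sets.xget_unique.
  by split=> //; exists n, rG.
move=> k [k_gt0 [l [rG' [irr_rG' Dk]]]].
have sim : mx_rsim rG rG'.
  by apply: (rat_irr_rsim_constt irr_rG irr_rG' irr_chi);
    rewrite ?Dm ?Dk pnatr_eq0 -lt0n.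
by apply/eqP; rewrite -(eqr_nat algC) -Dk -(rat_char_rsim sim) Dm.
Qed.

Lemma cfdot_rat_char_conj n (rG : mx_representation rat G n) chi :
  chi \is a character -> '[rat_char rG, chi^*%CF] = '[rat_char rG, chi].
Proof.
move=> Nchi; rewrite -{1}(rat_char_aut Num.conj rG) cfdot_conjC.
by rewrite conj_natr ?Cnat_cfdot_char ?rat_char_char.
Qed.

Lemma cfdot_conj_sum chi : chi \in irr G -> '[conj_sum chi, chi] = 1.
Proof.
move=> irr_chi; rewrite /conj_sum; case: ifP => [_ | /negbT nonreal_chi].
  by rewrite irrWnorm.
have /irrP[i Di] : chi^*%CF \in irr G by rewrite cfAut_irr.
have /irrP[j Dj] := irr_chi; rewrite cfdotDl irrWnorm // Di Dj cfdot_irr.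
case: eqP => [ij | _]; last by rewrite addr0.
by move: nonreal_chi; rewrite /cfReal Di Dj ij eqxx.
Qed.

Lemma cfdot_rat_char_conj_sum n (rG : mx_representation rat G n) chi :
    chi \is a character -> '[rat_char rG, chi] = 0 ->
  '[rat_char rG, conj_sum chi] = 0.
Proof.
move=> Nchi z; rewrite /conj_sum; case: ifP => // _.
by rewrite cfdotDr cfdot_rat_char_conj // z addr0.
Qed.

(** Scalar products of characters are nonnegative, so [r1] is orthogonal to
    itself. *)
Lemma rat_char_summand_eq0 n1 n2 (r1 : mx_representation rat G n1)
    (r2 : mx_representation rat G n2) phi :
    phi = rat_char r1 + rat_char r2 -> '[rat_char r1, phi] = 0 ->
  n1 = 0%N.
Proof.
move=> ->; rewrite cfdotDr => /eqP.
have [N1 N2] := (rat_char_char r1, rat_char_char r2).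
rewrite paddr_eq0 ?natr_ge0 ?Cnat_cfdot_char // cfnorm_eq0 => /andP[/eqP z _].
by apply/eqP; rewrite -(eqr_nat algC) -(rat_char1 r1) z cfunE.
Qed.

Lemma rat_char_constt_gt0 n (rG : mx_representation rat G n) chi :
  '[rat_char rG, chi] != 0 -> (0 < n)%N.
Proof.
apply: contraR; rewrite -eqn0Ngt => /eqP n0.
have /eqP : rat_char rG 1%g = 0 by rewrite rat_char1 n0.
by rewrite char1_eq0 ?rat_char_char // => /eqP->; rewrite cfdot0l.
Qed.

(** If [rG] splits, only one summand contains [chi]; the other one does not
    contain [chi^*] either, for its character is rational, so it is 0. *)
Lemma conj_sum_irreducible n (rG : mx_representation rat G n) chi :
    chi \in irr G -> rat_char rG = conj_sum chi ->
  mx_irreducible rG.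
Proof.
move=> irr_chi DrG; have Nchi := irrWchar irr_chi.
have mult_chi : '[rat_char rG, chi] = 1 by rewrite DrG cfdot_conj_sum.
apply: rat_char_irreducible => [|n1 n2 r1 r2 split_rG].
  by apply: (@rat_char_constt_gt0 _ rG chi); rewrite mult_chi oner_eq0.
have [N1 N2] := (rat_char_char r1, rat_char_char r2).
have := mult_chi; rewrite split_rG cfdotDl.
have /natrP[[|a] Da] := Cnat_cfdot_char N1 Nchi.
  by left; apply: (rat_char_summand_eq0 split_rG);
    rewrite DrG cfdot_rat_char_conj_sum.
have /natrP[[|b] Db] := Cnat_cfdot_char N2 Nchi; last first.
  by rewrite Da Db -natrD => /eqP; rewrite pnatr_eq1 addnS.
rewrite addrC in split_rG.
by right; apply: (rat_char_summand_eq0 split_rG);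
    rewrite DrG cfdot_rat_char_conj_sum.
Qed.

(** A summand containing [chi] twice is everything, and one that contains [chi]
    once would afford [chi]. *)
Lemma double_irreducible n (rG : mx_representation rat G n) chi :
    chi \in irr G -> rat_char rG = chi *+ 2 ->
    (forall m (r : mx_representation rat G m), rat_char r != chi) ->
  mx_irreducible rG.
Proof.
move=> irr_chi DrG not_rat; have Nchi := irrWchar irr_chi.
have mult_chi : '[rat_char rG, chi] = 2%:R.
  by rewrite DrG cfdotMnl irrWnorm.
apply: rat_char_irreducible => [|n1 n2 r1 r2 split_rG].
  by apply: (@rat_char_constt_gt0 _ rG chi); rewrite mult_chi pnatr_eq0.
have [N1 N2] := (rat_char_char r1, rat_char_char r2).
have := mult_chi; rewrite split_rG cfdotDl.
have /natrP[[|a] Da] := Cnat_cfdot_char N1 Nchi.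
  by left; apply: (rat_char_summand_eq0 split_rG);
    rewrite DrG cfdotMnr Da mul0rn.
have /natrP[[|b] Db] := Cnat_cfdot_char N2 Nchi.
  rewrite addrC in split_rG.
  by right; apply: (rat_char_summand_eq0 split_rG);
    rewrite DrG cfdotMnr Db mul0rn.
rewrite Da Db -natrD => /eqP; rewrite eqr_nat addSn addnS !eqSS addn_eq0.
case/andP => /eqP a0 _; case/negP: (not_rat _ r1); apply/eqP.
have /irrP[i Dchi] := irr_chi.
rewrite (cfun_sum_cfdot (rat_char r1)) (bigD1 i) //= -Dchi Da a0 scale1r.
rewrite big1 ?addr0 // => j ji; apply/eqP; rewrite scaler_eq0; apply/orP; left.
have /eqP: '[rat_char rG, 'chi_j] = 0.
  by rewrite DrG Dchi cfdotMnl cfdot_irr eq_sym (negPf ji) mul0rn.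
rewrite split_rG cfdotDl paddr_eq0 ?natr_ge0 ?Cnat_cfdot_char_irr //.
by case/andP.
Qed.

End SchurIndex.

(** * Rational models of Gaussian linear characters, and quaternions *)

Definition ratRe (a : algC) : rat := getCrat ('Re a).
Definition ratIm (a : algC) : rat := getCrat ('Im a).

Lemma gaussian_rect a : gaussian a -> a = ratr (ratRe a) + 'i * ratr (ratIm a).
Proof. by case/andP => ratR ratI; rewrite !getCratK // -Crect. Qed.

Lemma ratRe_rect p q : ratRe (ratr p + 'i * ratr q) = p.
Proof. by rewrite /ratRe Re_rect ?Creal_Crat ?Crat_rat // ratCK. Qed.

Lemma ratIm_rect p q : ratIm (ratr p + 'i * ratr q) = q.
Proof. by rewrite /ratIm Im_rect ?Creal_Crat ?Crat_rat // ratCK. Qed.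

Lemma gaussian_mul a b : gaussian a -> gaussian b ->
  a * b = ratr (ratRe a * ratRe b - ratIm a * ratIm b)
          + 'i * ratr (ratRe a * ratIm b + ratIm a * ratRe b).
Proof.
move=> /gaussian_rect {1}-> /gaussian_rect {1}->.
move: (ratRe a) (ratIm a) (ratRe b) (ratIm b) => p q r s.
rewrite (rmorphB _ (p * r)) (rmorphD _ (p * s)).
rewrite !(rmorphM (ratr : {rmorphism rat -> algC})) /=.
move: (ratr p) (ratr q) (ratr r) (ratr s) (sqrCi algC) => P Q R S i2.
by ring: i2.
Qed.

Section GaussianRepresentation.

Variables (gT : finGroupType) (H : {group gT}) (psi : 'CF(H)).
Hypotheses (lin_psi : psi \is a linear_char).
Hypothesis gauss_psi : forall h, gaussian (psi h).

Section Model.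

(* The matrix [J] stands for i; its square is constrained only if psi has a
   nonreal value, so that a rational psi can be modelled in dimension 1. *)

Variables (n : nat) (J : 'M[rat]_n).
Hypothesis J_sqr : forall g h, g \in H -> h \in H ->
  (ratIm (psi g) * ratIm (psi h)) *: (J *m J + 1%:M) = 0.

Definition gaussian_mx (h : gT) : 'M[rat]_n :=
  (ratRe (psi h))%:M + ratIm (psi h) *: J.

Lemma gaussian_mx_repr : mx_repr H gaussian_mx.
Proof.
have one_rect : 1 = ratr 1 + 'i * ratr 0 :> algC.
  by rewrite rmorph1 rmorph0 mulr0 addr0.
split=> [|g h Hg Hh].
  rewrite /gaussian_mx lin_char1 // one_rect ratRe_rect ratIm_rect.
  by rewrite scale0r addr0.
rewrite /gaussian_mx lin_charM // gaussian_mul // ratRe_rect ratIm_rect.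
have := J_sqr Hg Hh.
move: (ratRe _) (ratIm _) (ratRe _) (ratIm _) => p q r s.
move/eqP; rewrite scalerDr addr_eq0 scalemx1 => /eqP JJ.
rewrite mulmxDl !mulmxDr -scalar_mxM mul_scalar_mx mul_mx_scalar.
rewrite -scalemxAl -scalemxAr !scalerA JJ.
rewrite raddfB /= scalerDl [s * p]mulrC -!addrA; congr (_ + _).
by rewrite addrC !addrA [r * q]mulrC.
Qed.

Definition gaussian_repr := MxRepresentation gaussian_mx_repr.

Lemma rat_char_gaussian_repr h : h \in H ->
  rat_char gaussian_repr h =
    n%:R * ratr (ratRe (psi h)) + ratr (ratIm (psi h) * \tr J).
Proof.
move=> Hh; rewrite rat_charE //= mxtraceD mxtrace_scalar mxtraceZ rmorphD /=.
by rewrite rmorphMn /= mulr_natl.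
Qed.

End Model.

(** The field generated by the values of [psi], as a rational vector space on
    which [H] acts by multiplication by [psi]: dimension 1 if [psi] is real,
    dimension 2 otherwise. *)
Lemma conj_sum_afforded :
  exists n (r : mx_representation rat H n), rat_char r = conj_sum psi.
Proof.
have trace2 a : gaussian a -> a + a^* = 2%:R * ratr (ratRe a).
  case/andP => ratR _; rewrite /ratRe getCratK // ReE mulrC divfK //.
  by rewrite pnatr_eq0.
rewrite /conj_sum; case: ifP => [real_psi | _].
  have im0 h : ratIm (psi h) = 0.
    have psi_real : (psi h)^* = psi h by rewrite -[in RHS](eqP real_psi) cfunE.
    have /CratP[p Dp] := gaussian_real (gauss_psi h) psi_real.
    have -> : psi h = ratr p + 'i * ratr 0 by rewrite rmorph0 mulr0 addr0.
    exact: ratIm_rect.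
  have J_sqr g h : g \in H -> h \in H ->
      (ratIm (psi g) * ratIm (psi h)) *: ((0 : 'M[rat]_1) *m 0 + 1%:M) = 0.
    by rewrite im0 mul0r scale0r.
  exists 1, (gaussian_repr J_sqr); apply/cfun_inP => h Hh.
  rewrite rat_char_gaussian_repr // mul1r mxtrace0 mulr0 rmorph0 addr0.
  by rewrite [RHS](gaussian_rect (gauss_psi h)) im0 rmorph0 mulr0 addr0.
pose J : 'M[rat]_2 :=
  \matrix_(i, j) if (i : nat) == j then 0 else if i == 0 then 1 else -1.
have J2 : J *m J + 1%:M = 0.
  apply/matrixP => i j; rewrite !mxE big_ord_recl big_ord1 !mxE.
  by case: i j => [[|[|[]]] //= ?] [[|[|[]]] //= ?].
have J_sqr g h : g \in H -> h \in H ->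
  (ratIm (psi g) * ratIm (psi h)) *: (J *m J + 1%:M) = 0.
  by rewrite J2 scaler0.
exists 2, (gaussian_repr J_sqr); apply/cfun_inP => h Hh.
rewrite rat_char_gaussian_repr //.
have -> : \tr J = 0 by rewrite /mxtrace big_ord_recl big_ord1 !mxE addr0.
by rewrite mulr0 rmorph0 addr0 -trace2 // [RHS]cfunE [(_^*)%CF _]cfunE.
Qed.

End GaussianRepresentation.

Section Quaternion.

(** The rational quaternions are a division algebra of dimension 4, so they do not
    embed in the 2 x 2 matrices. For A = (a b; c d) and B = (p q; r s), the
    relations at the top left entry give a sum of squares equal to 0. *)
Lemma no_rational_quaternion_mx (A B : 'M[rat]_2) :
  A *m A = -1%:M -> B *m B = -1%:M -> A *m B = - (B *m A) -> False.
Proof.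
move=> /matrixP A2 /matrixP B2 /matrixP AB.
have entry (M N : 'M[rat]_2) i j :
    (M *m N) i j = M i ord0 * N ord0 j + M i ord_max * N ord_max j.
  rewrite mxE big_ord_recl big_ord1; congr (_ + M i _ * N _ j);
  exact: val_inj.
have sqr00 (M : 'M[rat]_2) : M *m M =2 -1%:M ->
    M ord0 ord0 * M ord0 ord0 + M ord0 ord_max * M ord_max ord0 = -1.
  by move=> M2; rewrite -entry M2 !mxE.
have AB00 : (A *m B) ord0 ord0 + (B *m A) ord0 ord0 = 0.
  by rewrite AB mxE addNr.
move: (sqr00 A A2) (sqr00 B B2) AB00; rewrite !entry.
move: (A ord0 ord0) (A ord0 ord_max) (A ord_max ord0) => a b c.
move: (B ord0 ord0) (B ord0 ord_max) (B ord_max ord0) => p q r A00 B00 AB00.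
(* The relations a^2 + b c = p^2 + q r = -1, multiplied by q^2 and b^2, and
   2 a p + b r + q c = 0, multiplied by b q, eliminate c and r. *)
have sum_sqr : (b * p - a * q) ^+ 2 + b ^+ 2 + q ^+ 2 = 0.
  transitivity (b ^+ 2 * (p * p + q * r + 1) + q ^+ 2 * (a * a + b * c + 1)
                - b * q * (a * p + b * r + (p * a + q * c))); first by ring.
  by rewrite A00 B00 AB00 !addNr !mulr0 addr0 subr0.
have b0 : b = 0.
  move/eqP: sum_sqr; rewrite !paddr_eq0 ?addr_ge0 ?sqr_ge0 //.
  by rewrite [b ^+ 2 == 0]sqrf_eq0 => /andP[/andP[_ /eqP]].
rewrite b0 mul0r addr0 in A00.
by have := sqr_ge0 a; rewrite expr2 A00 oppr_ge0 ler10.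
Qed.

Variables (gT : finGroupType) (G : {group gT}).

(** Character values with the modulus of the degree come from scalar matrices. *)
Lemma rat_char_opp_degree n (r : mx_representation rat G n) g :
  g \in G -> rat_char r g = - rat_char r 1%g -> r g = -1%:M.
Proof.
move=> Gg Dg; case: n r Dg => [|n] r Dg.
  by rewrite [LHS]thinmx0 [RHS]thinmx0.
have: g \in 'Z(rat_char r)%CF.
  by rewrite char_cfcenterE ?rat_char_char // Dg normrN rat_char1 normr_nat.
rewrite cfcenter_repr inE => /andP[_ /is_scalar_mxP[c rgc]].
have c_opp : c = -1.
  move: Dg; rewrite rat_char1 rat_charE // -trace_map_mx.
  rewrite -[map_mx _ _]/(map_repr (@ratr algC) r g) rgc mxtrace_scalar.
  rewrite -mulNrn => /eqP; rewrite -subr_eq0 -mulrnBl mulrn_eq0 /= subr_eq0.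
  by move/eqP.
apply: (map_mx_inj (f := (ratr : {rmorphism rat -> algC}))).
rewrite -[LHS]/(map_repr (@ratr algC) r g) rgc c_opp.
by rewrite map_mxN map_mx1 raddfN.
Qed.

Lemma quaternion_not_rational a b n (r : mx_representation rat G n) :
    a \in G -> b \in G -> rat_char r 1%g = 2%:R ->
    {in [:: (a ^+ 2); (b ^+ 2); [~ a, b]]%g,
       forall g, rat_char r g = - rat_char r 1%g} ->
  False.
Proof.
move=> Ga Gb deg2 opp; have n2 : n = 2%N.
  by apply/eqP; rewrite -(eqr_nat algC) -(rat_char1 r) deg2.
move: r deg2 opp; rewrite n2 => r _ opp.
have r_opp g : g \in G -> g \in [:: (a ^+ 2); (b ^+ 2); [~ a, b]]%g ->
    r g = -1%:M.
  by move=> Gg /opp; apply: rat_char_opp_degree.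
apply: (@no_rational_quaternion_mx (r a) (r b)).
- rewrite -repr_mxM // -[(a * a)%g]/(a ^+ 2)%g.
  by rewrite r_opp ?groupX ?inE ?eqxx.
- rewrite -repr_mxM // -[(b * b)%g]/(b ^+ 2)%g.
  by rewrite r_opp ?groupX ?inE ?eqxx ?orbT.
rewrite -!repr_mxM // commgC (repr_mxM r (groupM Gb Ga)) ?groupR //.
by rewrite (r_opp [~ a, b]%g) ?groupR ?inE ?eqxx ?orbT // mulmxN mulmx1.
Qed.

End Quaternion.

(** * Pairs inducing a character with values in Q(i) *)

Section GaussianPair.

Variables (gT : finGroupType) (G H : {group gT}) (psi : 'CF(H)).
Hypotheses (sHG : H \subset G) (lin_psi : psi \is a linear_char).
Hypothesis gauss_psi : forall h, gaussian (psi h).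

Let chi := 'Ind[G] psi.
Hypotheses (irr_chi : chi \in irr G) (gauss_chi : forall g, gaussian (chi g)).
Hypothesis quaternionic_chi : cfReal chi -> ~~ cfReal psi ->
  forall n (r : mx_representation rat G n), rat_char r != chi.

Let Nchi : chi \is a character. Proof. exact: irrWchar. Qed.
Let Npsi : psi \is a character. Proof. exact: lin_charW. Qed.
Let irr_psi : psi \in irr H. Proof. exact: lin_char_irr. Qed.

Let Omega_psi : Omega psi = conj_sum psi.
Proof.
have [n [Psi DPsi]] := conj_sum_afforded lin_psi gauss_psi.
rewrite Omega_gaussian // (@schur_indexE _ _ n Psi psi 1) //.
  exact: conj_sum_irreducible DPsi.
by rewrite DPsi cfdot_conj_sum.
Qed.

Lemma Omega_linear_afforded : exists n (Psi : mx_representation rat H n),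
  mx_irreducible Psi /\ rat_char Psi = Omega psi.
Proof.
have [n [Psi DPsi]] := conj_sum_afforded lin_psi gauss_psi.
exists n, Psi; rewrite Omega_psi; split=> //.
exact: conj_sum_irreducible DPsi.
Qed.

(* If chi is real, both psi and psi^* induce chi. *)
Let mult := if cfReal chi && ~~ cfReal psi then 2%N else 1%N.

Let Ind_conj_sum : 'Ind[G] (conj_sum psi) = conj_sum chi *+ mult.
Proof.
have real_Ind : cfReal psi -> cfReal chi.
  by move=> /eqP Rpsi; rewrite /cfReal /chi conj_cfInd Rpsi.
rewrite /conj_sum /mult; case: ifP real_Ind => [_ -> // | _ _]; rewrite andbT.
by rewrite raddfD /= -conj_cfInd -/chi; case: ifP => [/eqP-> | ].
Qed.

Let Ind_irreducible n (R : mx_representation rat G n) :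
  rat_char R = 'Ind[G] (conj_sum psi) -> mx_irreducible R.
Proof.
rewrite Ind_conj_sum /mult /conj_sum; case: (boolP (cfReal chi)) => real_chi.
  case: (boolP (cfReal psi)) => real_psi /= DR.
    by apply: (conj_sum_irreducible irr_chi); rewrite /conj_sum real_chi.
  exact: double_irreducible irr_chi DR (quaternionic_chi real_chi real_psi).
move=> DR; apply: (conj_sum_irreducible irr_chi).
by rewrite /conj_sum (negPf real_chi).
Qed.

Let schur_chi : schur_index chi = mult.
Proof.
have [n [Psi [_ DPsi]]] := Omega_linear_afforded.
have DR : rat_char (ind_repr sHG Psi) = 'Ind[G] (conj_sum psi).
  by rewrite rat_char_ind DPsi Omega_psi.
apply: (schur_indexE irr_chi (Ind_irreducible DR)).
  by rewrite /mult; case: ifP.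
by rewrite DR Ind_conj_sum cfdotMnl cfdot_conj_sum.
Qed.

Lemma Ind_Omega : 'Ind[G] (Omega psi) = Omega chi.
Proof. by rewrite Omega_psi Ind_conj_sum Omega_gaussian // schur_chi. Qed.

Lemma Ind_Omega_irreducible n (Psi : mx_representation rat H n) :
  rat_char Psi = Omega psi -> mx_irreducible (ind_repr sHG Psi).
Proof.
by move=> DPsi; apply: Ind_irreducible; rewrite rat_char_ind DPsi Omega_psi.
Qed.

Lemma Omega_constt : '[Omega chi, chi] != 0.
Proof.
rewrite Omega_gaussian // schur_chi cfdotMnl cfdot_conj_sum // pnatr_eq0.
by rewrite /mult; case: ifP.
Qed.

Lemma gaussian_special_pair : special_required_pair chi psi.
Proof.
split=> //; rewrite schur_chi /mult.
  case: (boolP (cfReal chi)) => [real_chi | nonreal_chi _].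
    case: (boolP (cfReal psi)) => //= real_psi _.
    by rewrite !char_field_real.
  rewrite !char_field_nonreal //; apply: contra nonreal_chi => /eqP Rpsi.
  by rewrite /cfReal /chi conj_cfInd Rpsi.
case: ifP => // /andP[real_chi nonreal_psi] _.
rewrite (char_field_real G gauss_chi real_chi) sub1v; split=> //.
by rewrite (dim_char_field_nonreal sHG) // dimv1 divn1.
Qed.

End GaussianPair.

(** * Abelian subgroups of index 2 containing a center of index 4 *)

Section CentralExtensions.

Variables (gT : finGroupType) (G H : {group gT}) (e w : gT).
Hypotheses (sZH : 'Z(G) \subset H) (sHG : H \subset G) (cHH : abelian H).
Hypotheses (iHG : #|G : H| = 2%N) (iZG : #|G : 'Z(G)| = 4%N).
Hypotheses (Hw : w \in H) (notZw : w \notin 'Z(G)).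
Hypotheses (derG : G^`(1)%g = <[e]>%g) (Ze : e \in 'Z(G)) (e2 : (e ^+ 2 = 1)%g).
Hypothesis exp4H : forall h, h \in H -> (h ^+ 4 = 1)%g.

Let nsHG : H <| G. Proof. exact: index2_normal. Qed.

Let iZH : #|H : 'Z(G)| = 2%N.
Proof.
have := mulnA #|'Z(G)| #|H : 'Z(G)| #|G : H|.
rewrite Lagrange // Lagrange // iHG -(Lagrange (center_sub G)) iZG.
move/eqP; rewrite eqn_pmul2l ?cardG_gt0 // => /eqP/(congr1 half).
by rewrite muln2 doubleK.
Qed.

Lemma decomp_index2 h : h \in H -> h \notin 'Z(G) -> (h * w^-1)%g \in 'Z(G).
Proof.
have HZw : w \in H :\: 'Z(G) by rewrite in_setD notZw.
move=> Hh notZh; rewrite -mem_rcoset (rcoset_index2 sZH iZH HZw).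
by rewrite in_setD notZh.
Qed.

Lemma commg_eq_e g h :
  g \in G -> h \in G -> [~ g, h]%g != 1%g -> [~ g, h]%g = e.
Proof.
move=> Gg Gh; have: [~ g, h]%g \in <[e]>%g by rewrite -derG mem_commg.
case/cycleP => i ->; rewrite -(expg_mod i e2).
by have := ltn_pmod i (ltn0Sn 1); case: (i %% 2)%N => [|[|]] //;
  rewrite expg0 eqxx.
Qed.

Lemma conj_noncentral g : g \in G -> g \notin 'Z(G) ->
  exists2 t, t \in G & (g ^ t = g * e)%g.
Proof.
move=> Gg; rewrite inE Gg /= -sub_cent1 => /subsetPn[t Gt not_cgt].
exists t => //; rewrite conjg_mulR commg_eq_e //.
by apply: contra not_cgt => /commgP cgt; apply/cent1P.
Qed.

Lemma irr_over_lin mu : mu \in irr_over 'Z(G) G^`(1)%g -> mu \is a linear_char.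
Proof.
by case/andP => /irrP[i ->] _; apply/char_abelianP; apply: center_abelian.
Qed.

Lemma irr_over_e mu : mu \in irr_over 'Z(G) G^`(1)%g -> mu e = -1.
Proof.
move=> mu_over; have lin_mu := irr_over_lin mu_over.
have /eqP: mu e ^+ 2 = 1 by rewrite -lin_charX // e2 lin_char1.
rewrite sqrf_eq1 => /orP[] /eqP // mu_e.
case/andP: mu_over => _ /negP[]; rewrite derG cycle_subG /=.
by rewrite cfkerEchar ?lin_charW // in_set Ze mu_e lin_char1 ?eqxx.
Qed.

Section Extension.

Variables (mu : 'CF('Z(G))) (psi : 'CF(H)).
Hypotheses (mu_over : mu \in irr_over 'Z(G) G^`(1)%g).
Hypotheses (lin_psi : psi \is a linear_char) (res_psi : 'Res['Z(G)] psi = mu).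

Lemma res_psiE z : z \in 'Z(G) -> psi z = mu z.
Proof. by move=> Zz; rewrite -res_psi cfResE. Qed.

(** For [g] in [H] outside the center, some [t] conjugates [g] to [g * e]; as
    [psi e = -1], replacing [y] by [t * y] changes the sign of the sum of the
    [psi (g ^ y)], which is thus 0. *)
Lemma Ind_central_char : 'Ind[G] psi = central_char mu.
Proof.
apply/cfun_inP => g Gg; rewrite cfIndE // [RHS]cfunE.
have [Zg | notZg] := boolP (g \in 'Z(G)).
  have /centerP[_ cgG] := Zg.
  rewrite (eq_bigr (fun=> mu g)) => [|y Gy]; last first.
    by rewrite conjgE (cgG y Gy) mulKg res_psiE.
  rewrite sumr_const -[X in _ * X]mulr_natl mulrA; congr (_ * _).
  by rewrite -(Lagrange sHG) iHG natrM mulKf ?neq0CG.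
apply/eqP; rewrite mulf_eq0; apply/orP; right.
have [Hg | notHg] := boolP (g \in H); last first.
  rewrite big1 // => y Gy; rewrite cfun0 //.
  by rewrite memJ_norm // (subsetP (normal_norm nsHG)).
have [t Gt Dgt] := conj_noncentral Gg notZg.
rewrite -eqNr; apply/eqP; rewrite [RHS](reindex_inj (mulgI t)) -sumrN /=.
apply: eq_big => y; first by rewrite groupMl.
move=> Gy; have /centerP[_ ceG] := Ze.
have Hgy : (g ^ y)%g \in H by rewrite memJ_norm // (subsetP (normal_norm nsHG)).
have ey : (e ^ y)%g = e by rewrite conjgE (ceG y Gy) mulKg.
rewrite conjgM Dgt conjMg ey (lin_charM lin_psi Hgy (subsetP sZH _ Ze)).
by rewrite (res_psiE Ze) irr_over_e // mulrN1.
Qed.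

Lemma central_charE z : z \in 'Z(G) -> central_char mu z = 2%:R * mu z.
Proof. by move=> Zz; rewrite cfunE Zz. Qed.

Lemma central_char_irr : central_char mu \in irr G.
Proof.
rewrite irrEchar -{1}Ind_central_char cfInd_char ?lin_charW //=.
have on_Z : central_char mu \in 'CF(G, 'Z(G)).
  by apply/cfun_onP => g notZg; rewrite cfunE ifN.
rewrite (cfnormE on_Z) (eq_bigr (fun=> 4%:R)) => [|z Zz]; last first.
  rewrite central_charE // normrM normr_nat normC_lin_char ?irr_over_lin //.
  by rewrite mulr1 -natrX.
rewrite sumr_const -mulrnA mulnC -iZG Lagrange ?center_sub // mulVf //.
by rewrite neq0CG.
Qed.

Lemma linear_gaussian h : gaussian (psi h).
Proof.
have [Hh | notHh] := boolP (h \in H); last by rewrite cfun0 ?gaussian0.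
by apply: unity4_gaussian; rewrite -lin_charX // exp4H // lin_char1.
Qed.

Lemma central_char_gaussian g : gaussian (central_char mu g).
Proof.
rewrite cfunE; case: ifP => [Zg | _]; last exact: gaussian0.
by rewrite gaussian_natM // -res_psiE // linear_gaussian.
Qed.

Lemma cfReal_central_char : cfReal (central_char mu) -> cfReal mu.
Proof.
move=> /eqP/cfunP real_chi; apply/eqP/cfun_inP => z Zz.
have := real_chi z; rewrite [LHS]cfunE central_charE // rmorphM rmorph_nat.
by move/(mulfI _) => <-; rewrite ?pnatr_eq0 // cfunE.
Qed.

Lemma quaternionic_not_rational a b n (r : mx_representation rat G n) :
    [/\ a \in G, b \in G, (a ^+ 2)%g \in 'Z(G) & (b ^+ 2)%g \in 'Z(G)] ->
    [/\ mu (a ^+ 2)%g = -1, mu (b ^+ 2)%g = -1 & [~ a, b]%g != 1%g] ->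
  rat_char r != central_char mu.
Proof.
move=> [Ga Gb Za Zb] [mu_a mu_b nab]; apply/eqP => Dr.
have lin_mu := irr_over_lin mu_over.
have deg2 : rat_char r 1%g = 2%:R.
  by rewrite Dr central_charE ?group1 // lin_char1 // mulr1.
apply: (quaternion_not_rational Ga Gb deg2).
have Z_opp z : z \in 'Z(G) -> mu z = -1 -> rat_char r z = - rat_char r 1%g.
  by move=> Zz mu_z; rewrite deg2 Dr central_charE // mu_z mulrN1.
move=> g; rewrite !inE => /or3P[] /eqP->; apply: Z_opp => //.
  by rewrite (commg_eq_e Ga Gb nab).
by rewrite (commg_eq_e Ga Gb nab) irr_over_e.
Qed.

End Extension.

(** [H] is generated by [w] and the center of [G]. *)
Lemma extension_uniq (psi1 psi2 : 'CF(H)) :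
    psi1 \is a linear_char -> psi2 \is a linear_char ->
    'Res['Z(G)] psi1 = 'Res['Z(G)] psi2 -> psi1 w = psi2 w ->
  psi1 = psi2.
Proof.
move=> lin1 lin2 eqZ eqw; apply/cfun_inP => h Hh.
have eq_onZ z : z \in 'Z(G) -> psi1 z = psi2 z.
  by move=> Zz; rewrite -(cfResE psi1 sZH Zz) eqZ cfResE.
have [/eq_onZ // | /(decomp_index2 Hh) Zh] := boolP (h \in 'Z(G)).
have HZh := subsetP sZH _ Zh.
rewrite -(mulgKV w h) (lin_charM lin1 HZh Hw) (lin_charM lin2 HZh Hw).
by rewrite eqw eq_onZ.
Qed.

(** A constituent of the induced character extends [mu], as [H] is abelian; its
    value at [w] is [c] or [- c], and conjugation in [G] exchanges the two. *)
Lemma extension_ex mu c :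
    mu \in irr_over 'Z(G) G^`(1)%g -> c ^+ 2 = mu (w ^+ 2)%g ->
  exists2 psi : 'CF(H), psi \is a linear_char
    & 'Res['Z(G)] psi = mu /\ psi w = c.
Proof.
move=> mu_over c2; have lin_mu := irr_over_lin mu_over.
have [psi lin_psi res_psi] : exists2 psi : 'CF(H), psi \is a linear_char
    & 'Res['Z(G)] psi = mu.
  have /irrP[i Dmu] := lin_char_irr lin_mu.
  have [j] := neq0_has_constt (Ind_irr_neq0 i sZH).
  rewrite constt_Ind_Res => Cij; exists 'chi_j; first exact/char_abelianP.
  have lin_res : 'Res['Z(G)] 'chi[H]_j \is a linear_char.
    by apply/cfRes_lin_char/char_abelianP.
  have /irrP[k Dk] := lin_char_irr lin_res.
  by move: Cij; rewrite Dk constt_irr inE Dmu => /eqP->.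
have Zw2 : (w ^+ 2)%g \in 'Z(G).
  apply: contraR notZw => notZw2; have := decomp_index2 (groupX 2 Hw) notZw2.
  by rewrite expgS expg1 mulgK.
have : psi w ^+ 2 == c ^+ 2.
  by rewrite -lin_charX // c2 -res_psi cfResE.
rewrite eqf_sqr => /orP[] /eqP psi_w; first by exists psi.
(* Conjugation by an element moving w to w * e changes the sign at w, since
   mu e = -1, and fixes the center pointwise. *)
have [t Gt Dwt] := conj_noncentral (subsetP sHG _ Hw) notZw.
have nHt : t^-1%g \in 'N(H) by rewrite groupV (subsetP (normal_norm nsHG)).
exists (psi ^ t^-1)%CF; first by rewrite cfConjg_lin_char.
split; last first.
  rewrite cfConjgE // invgK Dwt (lin_charM lin_psi Hw (subsetP sZH _ Ze)) psi_w.
  by rewrite -(cfResE psi sZH Ze) res_psi irr_over_e // mulrN1 opprK.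
apply/cfun_inP => z Zz; rewrite cfResE // cfConjgE // invgK.
have /centerP[_ czG] := Zz.
by rewrite conjgE (czG t Gt) mulKg -res_psi cfResE.
Qed.

Variables (psi_spec : 'CF('Z(G)) -> 'CF(H) -> Prop) (c : 'CF('Z(G)) -> algC).
Hypothesis c_sqr : forall mu,
  mu \in irr_over 'Z(G) G^`(1)%g -> c mu ^+ 2 = mu (w ^+ 2)%g.
Hypothesis psi_specE : forall mu (psi : 'CF(H)),
  mu \in irr_over 'Z(G) G^`(1)%g -> psi \is a linear_char ->
  psi_spec mu psi <-> 'Res['Z(G)] psi = mu /\ psi w = c mu.
Hypothesis quaternionic_case : forall mu (psi : 'CF(H)),
  mu \in irr_over 'Z(G) G^`(1)%g -> psi \is a linear_char ->
  'Res['Z(G)] psi = mu -> psi w = c mu -> cfReal mu -> ~~ cfReal psi ->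
  exists a b,
    [/\ a \in G, b \in G, (a ^+ 2)%g \in 'Z(G) & (b ^+ 2)%g \in 'Z(G)]
    /\ [/\ mu (a ^+ 2)%g = -1, mu (b ^+ 2)%g = -1 & [~ a, b]%g != 1%g].

Section Pair.

Variables (mu : 'CF('Z(G))) (psi : 'CF(H)).
Hypotheses (mu_over : mu \in irr_over 'Z(G) G^`(1)%g).
Hypotheses (lin_psi : psi \is a linear_char) (spec_psi : psi_spec mu psi).

Let res_psi : 'Res['Z(G)] psi = mu.
Proof. by have [] := (psi_specE mu_over lin_psi).1 spec_psi. Qed.

Let psi_w : psi w = c mu.
Proof. by have [] := (psi_specE mu_over lin_psi).1 spec_psi. Qed.

Let DInd : 'Ind[G] psi = central_char mu.
Proof. exact: Ind_central_char. Qed.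

Let irr_Ind : 'Ind[G] psi \in irr G.
Proof. by rewrite DInd (central_char_irr mu_over lin_psi). Qed.

Let gauss_Ind g : gaussian ('Ind[G] psi g).
Proof. by rewrite DInd (central_char_gaussian lin_psi). Qed.

Let not_rational : cfReal ('Ind[G] psi) -> ~~ cfReal psi ->
  forall n (r : mx_representation rat G n), rat_char r != 'Ind[G] psi.
Proof.
rewrite DInd => /cfReal_central_char real_mu nonreal_psi n r.
have [a [b [ab_Z ab_mu]]] := 
  quaternionic_case mu_over lin_psi res_psi psi_w real_mu nonreal_psi.
exact: quaternionic_not_rational ab_Z ab_mu.
Qed.

Lemma spec_pair :
  [/\ special_required_pair (central_char mu) psi,
      exists n (Psi : mx_representation rat H n),
        mx_irreducible Psi /\ rat_char Psi = Omega psi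
    & forall n (Psi : mx_representation rat H n),
        mx_irreducible Psi -> rat_char Psi = Omega psi ->
        [/\ mx_irreducible (ind_repr sHG Psi),
            rat_char (ind_repr sHG Psi) = Omega (central_char mu)
          & ~~ (G^`(1)%g \subset rker (ind_repr sHG Psi))]].
Proof.
have gauss := linear_gaussian lin_psi; rewrite -DInd.
split; [exact: gaussian_special_pair | exact: Omega_linear_afforded |].
move=> n Psi _ DPsi.
have DOmega : rat_char (ind_repr sHG Psi) = Omega ('Ind[G] psi).
  rewrite rat_char_ind DPsi.
  exact: (Ind_Omega sHG lin_psi gauss irr_Ind gauss_Ind not_rational).
split; [|exact: DOmega|].
  exact: (Ind_Omega_irreducible sHG lin_psi gauss irr_Ind not_rational DPsi).
rewrite -cfker_rat_char DOmega; apply/negP => der_ker.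
have /irrP[i Di] := irr_Ind.
have : e \in cfker 'chi_i.
  rewrite -cycle_subG -derG (subset_trans der_ker) // -DOmega.
  apply: cfker_constt; first exact: rat_char_char.
  rewrite irr_consttE -Di DOmega.
  exact: (Omega_constt sHG lin_psi gauss irr_Ind gauss_Ind not_rational).
rewrite cfkerEchar ?irr_char // in_set -Di DInd !central_charE // => /andP[_].
rewrite irr_over_e // lin_char1 ?irr_over_lin // mulrN1 mulr1.
by rewrite eqNr pnatr_eq0.
Qed.

Lemma spec_pair_constt n (Psi : mx_representation rat H n) :
    rat_char Psi = Omega psi ->
  '[rat_char (ind_repr sHG Psi), central_char mu] != 0.
Proof.
move=> DPsi; have gauss := linear_gaussian lin_psi.
rewrite rat_char_ind DPsi -DInd.
rewrite (Ind_Omega sHG lin_psi gauss irr_Ind gauss_Ind not_rational).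
exact: (Omega_constt sHG lin_psi gauss irr_Ind gauss_Ind not_rational).
Qed.

End Pair.

(** A constituent [psi] of the restriction to the abelian group [H] is linear, so
    ['Ind psi] is some [central_char mu], which is irreducible. The kernel of
    [mu] does not contain [G'], since that of ['Ind psi] does not. *)
Lemma nonlinear_central_char i :
    ~~ (G^`(1)%g \subset cfker 'chi[G]_i) ->
  exists2 mu, mu \in irr_over 'Z(G) G^`(1)%g & 'chi_i = central_char mu.
Proof.
move=> notker; have [j Cij] := neq0_has_constt (Res_irr_neq0 H i).
have lin_j : 'chi[H]_j \is a linear_char by apply/char_abelianP.
have mu_over : 'Res['Z(G)] 'chi_j \in irr_over 'Z(G) G^`(1)%g.
  rewrite inE lin_char_irr ?cfRes_lin_char //=.
  apply: contra notker => ker_mu.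
  have ker_j : G^`(1)%g \subset cfker 'chi_j.
    by rewrite (subset_trans ker_mu) // cfker_Res ?irr_char // subsetIr.
  have Cji : i \in irr_constt ('Ind[G] 'chi_j) by rewrite constt_Ind_Res.
  apply: subset_trans (cfker_constt _ Cji); last first.
    by rewrite cfInd_char ?irr_char.
  rewrite cfker_Ind_irr // sub_gcore //.
  exact: gFnorm.
exists ('Res 'chi_j) => //.
have := Ind_central_char mu_over lin_j erefl.
have /irrP[k ->] := central_char_irr mu_over lin_j erefl.
by move=> Dk; move: Cij; rewrite -constt_Ind_Res Dk constt_irr inE => /eqP->.
Qed.

(** The pairs cover every [rG] because [rG] has a constituent whose kernel does
    not contain [G'], and sharing it with an induced representation makes the two
    similar. *)
Theorem rational_reprs_from_extensions : rational_reprs_from_pairs psi_spec.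
Proof.
exists sHG; split.
- move=> mu mu_over.
  have [psi lin_psi psi_ext] := extension_ex mu_over (c_sqr mu_over).
  exists psi; split; first by split=> //; apply/psi_specE.
  move=> psi' [lin_psi' /(psi_specE mu_over lin_psi')[res' w']].
  have [res_psi psi_w] := psi_ext.
  by apply: extension_uniq; rewrite ?res' ?w'.
- move=> mu psi; exact: spec_pair.
move=> n rG irr_rG not_ker.
have [i Ci nk_i] : exists2 i, i \in irr_constt (rat_char rG)
    & ~~ (G^`(1)%g \subset cfker 'chi_i).
  apply/exists_inP; apply: contraR not_ker; rewrite negb_exists_in.
  move=> /forall_inP ker_i; rewrite -cfker_rat_char cfkerE ?rat_char_char //.
  rewrite subsetI der_sub; apply/bigcapsP => i Ci.
  by have := ker_i i Ci; rewrite negbK.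
have [mu mu_over Di] := nonlinear_central_char nk_i.
have [psi lin_psi psi_ext] := extension_ex mu_over (c_sqr mu_over).
have spec_psi : psi_spec mu psi by apply/psi_specE.
have [_ [m [Psi [irr_Psi DPsi]]] indP] := spec_pair mu_over lin_psi spec_psi.
have [irr_ind _ _] := indP m Psi irr_Psi DPsi.
exists mu, psi, m, Psi; split=> //.
apply: (rat_irr_rsim_constt irr_rG irr_ind (mem_irr i)).
  by rewrite -irr_consttE.
by rewrite Di; apply: spec_pair_constt spec_psi _ _ DPsi.
Qed.

End CentralExtensions.

(** * Groups generated by two elements over their center *)

Lemma lin_char_gen_eq (gT : finGroupType) (K : {group gT}) (S : {set gT})
    (xi1 xi2 : 'CF(K)) :
    K \subset <<S>>%g -> S \subset K ->
    xi1 \is a linear_char -> xi2 \is a linear_char -> {in S, xi1 =1 xi2} ->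
  xi1 = xi2.
Proof.
move=> genK sSK lin1 lin2 eqS; apply/cfun_inP => k Kk.
have eq_group : group_set [set g in K | xi1 g == xi2 g].
  apply/group_setP; split=> [|g h]; first by rewrite inE group1 !lin_char1 /=.
  rewrite !inE => /andP[Kg /eqP eqg] /andP[Kh /eqP eqh].
  by rewrite groupM //= !lin_charM // eqg eqh.
have: k \in Group eq_group.
  apply: subsetP Kk; rewrite (subset_trans genK) // gen_subG.
  by apply/subsetP => s Ss; rewrite inE (subsetP sSK) //= eqS.
by rewrite inE => /andP[_ /eqP].
Qed.

Lemma center_gen (gT : finGroupType) (G : {group gT}) (A : {set gT}) z :
    G \subset <<A>>%g -> z \in G -> {in A, forall g, [~ z, g]%g = 1%g} ->
  z \in 'Z(G).
Proof.
move=> genG Gz cAz; rewrite inE Gz -sub_cent1 (subset_trans genG) // gen_subG.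
by apply/subsetP => g Ag; apply/cent1P/commute_sym/commgP/eqP; apply: cAz.
Qed.

Lemma order_coset_le2 (gT : finGroupType) (T : {group gT}) t :
  t \in 'N(T)%g -> (t ^+ 2)%g \in T -> (#[coset T t] <= 2)%N.
Proof.
move=> Nt Tt2; rewrite dvdn_leq // order_dvdn -morphX //.
by apply/eqP; apply: coset_id.
Qed.

Section TwoGeneratorsOverCenter.

Variables (gT : finGroupType) (G H : {group gT}) (S : {set gT}) (a b e : gT).
Hypotheses (nabG : ~~ abelian G) (sSZ : S \subset 'Z(G)).
Hypotheses (Ga : a \in G) (Gb : b \in G) (genG : G \subset <<a |: (b |: S)>>%g).
Hypotheses (Sa2 : (a ^+ 2)%g \in <<S>>%g) (Sb2 : (b ^+ 2)%g \in <<S>>%g).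
Hypotheses (Dab : [~ a, b]%g = e) (Se : e \in <<S>>%g).

Let sSZgen : <<S>>%g \subset 'Z(G). Proof. by rewrite gen_subG. Qed.

(* If a and b commuted, the generators of G would be central. *)
Let e_neq1 : e != 1%g.
Proof.
apply: contra nabG => /eqP e1; have cab : [~ a, b]%g = 1%g by rewrite Dab.
suff sGZ : G \subset 'Z(G) by rewrite /abelian (subset_trans sGZ) ?subsetIr.
have cSG s g : s \in S -> g \in G -> [~ g, s]%g = 1%g.
  move=> Ss Gg; have /centerP[_ csG] := subsetP sSZ _ Ss.
  by apply/eqP/commgP; apply: commute_sym; apply: csG.
rewrite (subset_trans genG) // gen_subG !subUset !sub1set sSZ andbT.
apply/andP; split; apply: center_gen genG _ _ => // g;
  rewrite !inE => /or3P[/eqP-> | /eqP-> | /cSG->] //; try exact: commgg.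
by rewrite -invg_comm cab invg1.
Qed.

Let notZb : b \notin 'Z(G).
Proof.
apply: contra e_neq1 => /centerP[_ cbG].
by rewrite -Dab; apply/commgP; apply: commute_sym; apply: cbG.
Qed.

Let Ze : e \in 'Z(G). Proof. exact: (subsetP sSZgen). Qed.

Let e2 : (e ^+ 2 = 1)%g.
Proof.
have /centerP[_ ceG] := Ze.
rewrite -Dab -commXg; last by rewrite Dab; apply: commute_sym; apply: ceG.
have /centerP[_ ca2G] := subsetP sSZgen _ Sa2.
by apply/eqP/commgP; apply: ca2G.
Qed.

Let K := (<[a]> <*> <[b]>)%G.

Let sKG : K \subset G.
Proof. by rewrite join_subG !cycle_subG Ga. Qed.

Let DG : (<<S>> * K = G)%g.
Proof.
have cKS : K \subset 'C(<<S>>)%g.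
  by rewrite (subset_trans sKG) // centsC (subset_trans sSZgen) ?subsetIr.
rewrite -(cent_joinEr cKS); apply/eqP; rewrite eqEsubset join_subG sKG andbT.
rewrite (subset_trans sSZgen) ?center_sub //= (subset_trans genG) // gen_subG.
have sKJ := joing_subr <<S>> K.
rewrite !subUset !sub1set (subset_trans (subset_gen S)) ?joing_subl // andbT.
by rewrite !(subsetP sKJ) // mem_gen // inE cycle_id ?orbT.
Qed.

Let derG_e : G^`(1)%g = <[e]>%g.
Proof.
have cSK : <<S>>%g \subset 'C(K).
  by rewrite (subset_trans sSZgen) // (subset_trans (subsetIr _ _)) ?centS.
have /(der_cprod 1) : (<<S>> \* K = G)%g by rewrite cprodE // centsC.
have -> : (<<S>>^`(1) = 1)%g.
  apply/derG1P; rewrite abelian_gen.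
  by rewrite (abelianS sSZ) ?center_abelian.
rewrite cprod1g => <-; rewrite -Dab; apply: der1_joing_cycles.
rewrite Dab; apply: subsetP Ze.
by rewrite (subset_trans (subsetIr _ _)) ?centS.
Qed.

Let nSG : G \subset 'N(<<S>>)%g.
Proof. by rewrite cents_norm // centsC (subset_trans sSZgen) ?subsetIr. Qed.

(* G / <<S>> is generated by two commuting elements of order at most 2. *)
Let index_le4 : (#|G : <<S>>| <= 4)%N.
Proof.
have cGS : abelian (G / <<S>>)%g.
  by rewrite sub_der1_abelian // derG_e cycle_subG.
rewrite -card_quotient // -{1}DG quotientMidl.
have [Na Nb] := (subsetP nSG _ Ga, subsetP nSG _ Gb).
rewrite quotientY ?cycle_subG // !quotient_cycle //.
rewrite cent_joinEr; last first.
  by rewrite (sub_abelian_cent2 cGS) // cycle_subG mem_quotient.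
have := mul_cardG <[coset <<S>> a]> <[coset <<S>> b]>.
move/(congr1 (fun m => m <= 4)%N).
rewrite (leq_mul (order_coset_le2 Na Sa2) (order_coset_le2 Nb Sb2)).
by move/esym/(leq_trans _); apply; rewrite leq_pmulr ?cardG_gt0.
Qed.

(* A group of order less than 4 is cyclic, and G / 'Z(G) is not. *)
Let index_center_ge4 : (4 <= #|G : 'Z(G)|)%N.
Proof.
rewrite leqNgt; apply: contra nabG => lt4.
apply: cyclic_center_factor_abelian.
rewrite -card_quotient ?normal_norm ?center_normal // in lt4.
have [le1 | gt1] := leqP #|G / 'Z(G)|%g 1.
  by rewrite (card_le1_trivg le1) cyclic1.
by apply: prime_cyclic; move: lt4 gt1; case: #|_| => [|[|[|[|]]]].
Qed.

Let ZG : 'Z(G) = <<S>>%g.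
Proof.
have := Lagrange_index (center_sub G) sSZgen.
move=> DiGS; apply/esym/eqP; rewrite eqEcard sSZgen /=.
rewrite -(Lagrange sSZgen) -[X in (_ <= X)%N]muln1 leq_pmul2l ?cardG_gt0 //.
rewrite leqNgt; apply: contraL index_le4 => lt1.
by rewrite -DiGS -ltnNge (leq_trans _ (leq_mul index_center_ge4 lt1)).
Qed.

Let iZG : #|G : 'Z(G)| = 4%N.
Proof. by apply/eqP; rewrite eqn_leq index_center_ge4 ZG index_le4. Qed.

Hypotheses (cardG : #|G| = 16%N) (b4 : (b ^+ 4 = 1)%g).
Hypotheses (sSH : S \subset H) (Hb : b \in H) (genH : H \subset <<b |: S>>%g).

Let sHG : H \subset G.
Proof.
rewrite (subset_trans genH) // gen_subG subUset sub1set Gb.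
by rewrite (subset_trans sSZ) ?center_sub.
Qed.

Let sZH : 'Z(G) \subset H. Proof. by rewrite ZG gen_subG. Qed.

Let DH : ('Z(G) * <[b]> = H)%g.
Proof.
have cbZ : <[b]> \subset 'C('Z(G)).
  by rewrite centsC (subset_trans (subsetIr _ _)) // centS // cycle_subG.
rewrite -cent_joinEr //; apply/eqP.
rewrite eqEsubset join_subG sZH cycle_subG Hb /=.
rewrite (subset_trans genH) // gen_subG subUset sub1set.
rewrite (subset_trans sSZ) ?joing_subl // andbT.
by apply: (subsetP (joing_subr _ _)); apply: cycle_id.
Qed.

Let cHH : abelian H.
Proof.
rewrite -DH abelianM center_abelian cycle_abelian /=.
by rewrite centsC (subset_trans (subsetIr _ _)) // centS // cycle_subG.
Qed.

Let iHG : #|G : H| = 2%N.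
Proof.
have : (#|H : 'Z(G)| <= 2)%N.
  rewrite -card_quotient; last by rewrite (subset_trans sHG) // gFnorm.
  have Nb := subsetP (normal_norm (center_normal G)) b Gb.
  rewrite -DH quotientMidl quotient_cycle //.
  by apply: order_coset_le2 => //; apply: (subsetP sSZgen).
have : (1 < #|H : 'Z(G)|)%N.
  by rewrite indexg_gt1; apply: contra notZb => /subsetP; apply.
have := Lagrange_index sHG sZH; rewrite iZG.
by case: #|H : 'Z(G)| => [|[|[|]]] //; case: #|G : H| => [|[|[|]]].
Qed.

Let exp4H h : h \in H -> (h ^+ 4 = 1)%g.
Proof.
rewrite -DH => /mulsgP[z _ Zz /cycleP[i ->] ->].
have Gbi : (b ^+ i)%g \in G by rewrite groupX.
have /centerP[_ czG] := Zz.
rewrite expgMn; last exact: czG.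
rewrite -expgM mulnC expgM b4 expg1n mulg1; apply/eqP.
rewrite -order_dvdn; apply: dvdn_trans (order_dvdG Zz) _.
have := Lagrange (center_sub G); rewrite iZG cardG => card_eq.
by rewrite -(@dvdn_pmul2r 4) // card_eq.
Qed.

Variables (psi_spec : 'CF('Z(G)) -> 'CF(H) -> Prop) (c : 'CF('Z(G)) -> algC).
Hypothesis c_sqr : forall mu,
  mu \in irr_over 'Z(G) G^`(1)%g -> c mu ^+ 2 = mu (b ^+ 2)%g.
Hypothesis psi_specE : forall mu (psi : 'CF(H)),
  mu \in irr_over 'Z(G) G^`(1)%g -> psi \is a linear_char ->
  psi_spec mu psi <-> {in S, psi =1 mu} /\ psi b = c mu.
Hypothesis c_real : forall mu,
  mu \in irr_over 'Z(G) G^`(1)%g -> (c mu)^* = c mu \/ (a ^+ 2)%g = e.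

(** When [mu] is real and [c mu] is real, so is [psi]; thus the quaternionic case
    occurs only with [c mu] nonreal, where [mu (b ^+ 2)] and [mu e] are -1 and
    [a ^+ 2 = e] makes [a] and [b] generate a quaternion group modulo the kernel
    of [mu]. *)
Theorem rational_reprs_two_generators :
  [/\ 'Z(G) = <<S>>%g, G^`(1)%g = <[e]>%g & rational_reprs_from_pairs psi_spec].
Proof.
split=> //; apply: (rational_reprs_from_extensions sZH sHG cHH iHG iZG Hb notZb
  derG_e Ze e2 exp4H c_sqr).
  move=> mu psi mu_over lin_psi; have lin_mu := irr_over_lin mu_over.
  apply: (iff_trans (psi_specE mu_over lin_psi)); split=> -[eq_psi ->].
    split=> //; apply: (@lin_char_gen_eq _ _ S) => //.
    - by rewrite /= ZG.
    - exact: cfRes_lin_char.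
    by move=> s Ss; rewrite cfResE ?eq_psi ?(subsetP sSZ).
  by split=> // s Ss; rewrite -eq_psi cfResE ?(subsetP sSZ).
move=> mu psi mu_over lin_psi res_psi psi_b real_mu nonreal_psi.
have lin_mu := irr_over_lin mu_over.
have Zb2 : (b ^+ 2)%g \in 'Z(G) by apply: (subsetP sSZgen).
have nonreal_c : (c mu)^* != c mu.
  apply: contra nonreal_psi => /eqP real_c; apply/eqP.
  apply: (extension_uniq sZH sHG iHG iZG Hb notZb) => //.
  - by rewrite cfConjC_lin_char.
  - by rewrite -conj_cfRes res_psi; apply/eqP.
  by rewrite cfunE psi_b.
have a2e : (a ^+ 2)%g = e.
  by case: (c_real mu_over) => // real_c; rewrite real_c eqxx in nonreal_c.
exists a, b; split; first by rewrite a2e.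
rewrite Dab e_neq1 a2e (irr_over_e derG_e) //; split=> //.
have /eqP : mu (b ^+ 2)%g ^+ 2 = 1.
  by rewrite -lin_charX // -expgM b4 lin_char1.
rewrite sqrf_eq1 => /orP[] /eqP // mu_b2; case/negP: nonreal_c.
have /eqP := c_sqr mu_over; rewrite mu_b2 sqrf_eq1 => /orP[] /eqP->.
  by rewrite conjC1.
by rewrite rmorphN1.
Qed.

End TwoGeneratorsOverCenter.

(** The case [psi b = 1], in which [psi] is real whenever [mu] is. *)
Corollary rational_reprs_involution (gT : finGroupType) (G H : {group gT})
    (S : {set gT}) (a b e : gT)
    (psi_spec : 'CF('Z(G)) -> 'CF(H) -> Prop) :
    ~~ abelian G -> #|G| = 16%N -> S \subset 'Z(G) ->
    a \in G -> b \in G -> G \subset <<a |: (b |: S)>>%g ->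
    (a ^+ 2)%g \in <<S>>%g -> (b ^+ 2 = 1)%g ->
    [~ a, b]%g = e -> e \in <<S>>%g ->
    S \subset H -> b \in H -> H \subset <<b |: S>>%g ->
    (forall mu (psi : 'CF(H)), mu \in irr_over 'Z(G) G^`(1)%g ->
       psi \is a linear_char ->
       psi_spec mu psi <-> {in S, psi =1 mu} /\ psi b = 1) ->
  [/\ 'Z(G) = <<S>>%g, G^`(1)%g = <[e]>%g & rational_reprs_from_pairs psi_spec].
Proof.
move=> nabG cardG sSZ Ga Gb genG Sa2 b2 Dab Se sSH Hb genH spec.
apply: (rational_reprs_two_generators nabG sSZ Ga Gb genG Sa2 _ Dab Se cardG _
  sSH Hb genH _ spec) => [||mu mu_over|mu _]; last by left; rewrite conjC1.
- by rewrite b2 group1.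
- by rewrite (expgM b 2 2) b2 expg1n.
by rewrite expr1n b2 lin_char1 // (irr_over_lin mu_over).
Qed.

(** * The six groups *)

Lemma sqr_inv4 (gT : finGroupType) (x : gT) :
  (x ^+ 4 = 1 -> (x ^+ 2)^-1 = x ^+ 2)%g.
Proof. by move=> x4; apply/eqP; rewrite eq_invg_mul -expgD x4. Qed.

Lemma commg_sqr_eq1 (gT : finGroupType) (x y : gT) :
  ([~ x, [~ x, y]] = 1 -> [~ x, y] ^+ 2 = 1 -> [~ x ^+ 2, y] = 1)%g.
Proof. by move=> /eqP/commgP cx cxy2; rewrite commXg. Qed.

Lemma commgX1 (gT : finGroupType) (x : gT) i j : ([~ x ^+ i, x ^+ j] = 1)%g.
Proof. exact/eqP/commgP/commuteX2. Qed.

Lemma center_sqr_pair (gT : finGroupType) (G : {group gT}) (x y z : gT) :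
    <<[set x; y; z]>>%g = G ->
    [~ x, z]%g = 1%g -> [~ y, z]%g = 1%g -> [~ x ^+ 2, y]%g = 1%g ->
  [set (x ^+ 2)%g; z] \subset 'Z(G).
Proof.
move=> genG xz yz x2y; have := subset_gen [set x; y; z].
rewrite genG !subUset !sub1set => /andP[/andP[Gx Gy] Gz].
have Zz : z \in 'Z(G).
  apply: (@center_gen _ _ [set x; y; z]) => //; first by rewrite -genG.
  by move=> g; rewrite !inE => /orP[/orP[]|] /eqP->;
    rewrite -invg_comm ?xz ?yz ?commgg invg1.
rewrite Zz andbT.
apply: (@center_gen _ _ [set x; y; z]); [by rewrite -genG | exact: groupX |].
move=> g; rewrite !inE => /orP[/orP[]|] /eqP-> //; first exact: (commgX1 x 2 1).
have /centerP[_ czG] := Zz; apply/eqP/commgP/commute_sym.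
by apply: czG; apply: groupX.
Qed.

Theorem theorem50 (gT : finGroupType) (G : {group gT})
    (cardG : #|G| = 16%N) (nabG : ~~ abelian G) (classG : nil_class G = 2%N)
    (csqrt : algC -> algC) (csqrtP : forall a, csqrt a ^+ 2 = a) :
  (forall x y z : gT, presented_1 G x y z ->
    [/\ 'Z(G) = <[x]>%g, G^`(1)%g = <[x ^+ 2]>%g
      & rational_reprs_from_pairs (G := G) (H := <<[set x; y]>>%G)
          (fun mu psi => psi x = mu x /\ psi y = 1)])
  /\
  (forall x y : gT, presented_2 G x y ->
    [/\ 'Z(G) = <[x ^+ 2]>%g, G^`(1)%g = <[x ^+ 4]>%g
      & rational_reprs_from_pairs (G := G) (H := <<[set (x ^+ 2)%g; y]>>%G)
          (fun mu psi => psi (x ^+ 2)%g = mu (x ^+ 2)%g /\ psi y = 1)])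
  /\
  (forall x y z : gT, presented_3 G x y z ->
    [/\ 'Z(G) = <<[set (x ^+ 2)%g; z]>>%g, G^`(1)%g = <[x ^+ 2]>%g
      & rational_reprs_from_pairs (G := G) (H := <<[set (x ^+ 2)%g; y; z]>>%G)
          (fun mu psi =>
             [/\ psi (x ^+ 2)%g = mu (x ^+ 2)%g, psi y = 1 & psi z = mu z])])
  /\
  (forall x y z : gT, presented_4 G x y z ->
    [/\ 'Z(G) = <<[set (x ^+ 2)%g; z]>>%g, G^`(1)%g = <[z]>%g
      & rational_reprs_from_pairs (G := G) (H := <<[set (x ^+ 2)%g; y; z]>>%G)
          (fun mu psi =>
             [/\ psi (x ^+ 2)%g = mu (x ^+ 2)%g, psi y = 1 & psi z = mu z])])
  /\
  (forall x y : gT, presented_5 G x y ->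
    [/\ 'Z(G) = <<[set (x ^+ 2)%g; (y ^+ 2)%g]>>%g, G^`(1)%g = <[x ^+ 2]>%g
      & rational_reprs_from_pairs (G := G) (H := <<[set (x ^+ 2)%g; y]>>%G)
          (fun mu psi =>
             psi (x ^+ 2)%g = mu (x ^+ 2)%g
             /\ psi y = csqrt (mu (y ^+ 2)%g))])
  /\
  (forall x y z : gT, presented_6 G x y z ->
    [/\ 'Z(G) = <<[set (x ^+ 2)%g; z]>>%g, G^`(1)%g = <[x ^+ 2]>%g
      & rational_reprs_from_pairs (G := G) (H := <<[set x; z]>>%G)
          (fun mu psi =>
             psi x = csqrt (mu (x ^+ 2)%g) /\ psi z = mu z)]).
Proof.
have mem_gens (A : {set gT}) : <<A>>%g = G -> A \subset G.
  by move<-; apply: subset_gen.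
split; last split; last split; last split; last split.
- move=> x y z [_ genG [x4 y2 z2] [xy xz yz]].
  have := mem_gens _ genG; rewrite !subUset !sub1set => /andP[/andP[Gx Gy] Gz].
  have zy : [~ z, y]%g = (x ^+ 2)%g by rewrite -invg_comm yz sqr_inv4.
  apply: (rational_reprs_involution (S := [set x]) nabG cardG _ Gz Gy
    _ _ y2 zy).
  + rewrite sub1set; apply: (@center_gen _ _ [set x; y; z]) => //.
      by rewrite -genG.
    by move=> g; rewrite !inE => /orP[/orP[]|] /eqP-> //; rewrite commgg.
  + by rewrite -genG genS // !subUset !sub1set !inE !eqxx !orbT.
  + by rewrite z2 group1.
  + by rewrite groupX // mem_gen ?inE.
  + by rewrite sub_gen ?subsetUl.
  + by rewrite mem_gen // !inE eqxx orbT.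
  + by rewrite setUC.
  move=> mu psi _ _; split=> -[eq_psi ->]; split=> //; last first.
    by apply: eq_psi; rewrite inE.
  by move=> s /set1P->.
- move=> x y [_ genG [x8 y2] xy].
  have := mem_gens _ genG; rewrite !subUset !sub1set => /andP[Gx Gy].
  apply: (rational_reprs_involution (S := [set (x ^+ 2)%g]) nabG
    cardG _ Gx Gy _ _ y2 xy).
  + rewrite sub1set.
    apply: (@center_gen _ _ [set x; y]); [by rewrite -genG | exact: groupX |].
    move=> g; rewrite !inE => /orP[] /eqP->; first exact: (commgX1 x 2 1).
    by apply: commg_sqr_eq1; rewrite xy ?(commgX1 x 1 4) // -expgM x8.
  + by rewrite -genG genS // !subUset !sub1set !inE !eqxx !orbT.
  + by rewrite mem_gen ?inE.
  + by rewrite (expgM x 2 2) groupX // mem_gen ?inE.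
  + by rewrite sub_gen ?subsetUl.
  + by rewrite mem_gen // !inE eqxx orbT.
  + by rewrite setUC.
  move=> mu psi _ _; split=> -[eq_psi ->]; split=> //; last first.
    by apply: eq_psi; rewrite inE.
  by move=> s /set1P->.
- move=> x y z [_ genG [x4 y2 z2] [xz yz xy]].
  have := mem_gens _ genG; rewrite !subUset !sub1set => /andP[/andP[Gx Gy] Gz].
  apply: (rational_reprs_involution (S := [set (x ^+ 2)%g; z]) nabG
    cardG _ Gx Gy _ _ y2 xy).
  + apply: (center_sqr_pair genG) => //.
    by apply: commg_sqr_eq1; rewrite xy ?(commgX1 x 1 2) // -expgM x4.
  + by rewrite -genG genS // !subUset !sub1set !inE !eqxx !orbT.
  + by rewrite mem_gen // !inE eqxx.
  + by rewrite mem_gen // !inE eqxx.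
  + by rewrite sub_gen // !subUset !sub1set !inE !eqxx !orbT.
  + by rewrite mem_gen // !inE eqxx orbT.
  + by rewrite genS // !subUset !sub1set !inE !eqxx !orbT.
  move=> mu psi _ _; split=> [[eq_x -> eq_z] | [eq_psi ->]].
    by split=> // s; rewrite !inE => /orP[] /eqP->.
  by split=> //; apply: eq_psi; rewrite !inE eqxx ?orbT.
- move=> x y z [_ genG [x4 y2 z2] [xz yz xy]].
  have := mem_gens _ genG; rewrite !subUset !sub1set => /andP[/andP[Gx Gy] Gz].
  apply: (rational_reprs_involution (S := [set (x ^+ 2)%g; z]) nabG
    cardG _ Gx Gy _ _ y2 xy).
  + apply: (center_sqr_pair genG) => //.
    by apply: commg_sqr_eq1; rewrite xy.
  + by rewrite -genG genS // !subUset !sub1set !inE !eqxx !orbT.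
  + by rewrite mem_gen // !inE eqxx.
  + by rewrite mem_gen // !inE eqxx orbT.
  + by rewrite sub_gen // !subUset !sub1set !inE !eqxx !orbT.
  + by rewrite mem_gen // !inE eqxx orbT.
  + by rewrite genS // !subUset !sub1set !inE !eqxx !orbT.
  move=> mu psi _ _; split=> [[eq_x -> eq_z] | [eq_psi ->]].
    by split=> // s; rewrite !inE => /orP[] /eqP->.
  by split=> //; apply: eq_psi; rewrite !inE eqxx ?orbT.
- move=> x y [_ genG [x4 y4] xy].
  have := mem_gens _ genG; rewrite !subUset !sub1set => /andP[Gx Gy].
  have x2y : [~ x ^+ 2, y]%g = 1%g.
    by apply: commg_sqr_eq1; rewrite xy ?(commgX1 x 1 2) // -expgM x4.
  have y2x : [~ y ^+ 2, x]%g = 1%g.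
    have yx : [~ y, x]%g = (x ^+ 2)%g by rewrite -invg_comm xy sqr_inv4.
    apply: commg_sqr_eq1; rewrite yx -?expgM ?x4 //.
    by rewrite -invg_comm x2y invg1.
  apply: (rational_reprs_two_generators (S := [set (x ^+ 2)%g; (y ^+ 2)%g])
    (c := fun mu => csqrt (mu (y ^+ 2)%g)) nabG
    _ Gx Gy _ _ _ xy _ cardG y4 _ _ _).
  + rewrite subUset !sub1set; apply/andP; split.
      apply: (@center_gen _ _ [set x; y]); [by rewrite -genG | exact: groupX |].
      by move=> g; rewrite !inE => /orP[] /eqP-> //; apply: (commgX1 x 2 1).
    apply: (@center_gen _ _ [set x; y]); [by rewrite -genG | exact: groupX |].
    by move=> g; rewrite !inE => /orP[] /eqP-> //; apply: (commgX1 y 2 1).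
  + by rewrite -genG genS // !subUset !sub1set !inE !eqxx !orbT.
  + by rewrite mem_gen // !inE eqxx.
  + by rewrite mem_gen // !inE eqxx orbT.
  + by rewrite mem_gen // !inE eqxx.
  + rewrite subUset !sub1set; apply/andP.
    by split; last apply: groupX; rewrite mem_gen // !inE eqxx ?orbT.
  + by rewrite mem_gen // !inE eqxx orbT.
  + by rewrite genS // !subUset !sub1set !inE !eqxx !orbT.
  + by move=> mu _; apply: csqrtP.
  + move=> mu psi _ lin_psi; split=> [[eq_x psi_y] | [eq_psi ->]].
      split=> // s; rewrite !inE => /orP[] /eqP-> //.
      by rewrite lin_charX ?psi_y ?csqrtP // mem_gen // !inE eqxx orbT.
    by split=> //; apply: eq_psi; rewrite !inE eqxx.
  by move=> mu _; right.
move=> x y z [_ genG [x4 y4 z2] [xz yz xy xy2]].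
have := mem_gens _ genG; rewrite !subUset !sub1set => /andP[/andP[Gx Gy] Gz].
have yx : [~ y, x]%g = (x ^+ 2)%g by rewrite -invg_comm xy sqr_inv4.
apply: (rational_reprs_two_generators (S := [set (x ^+ 2)%g; z])
  (c := fun mu => csqrt (mu (x ^+ 2)%g)) nabG
  _ Gy Gx _ _ _ yx _ cardG x4 _ _ _).
- apply: (center_sqr_pair genG) => //.
  by apply: commg_sqr_eq1; rewrite xy ?(commgX1 x 1 2) // -expgM x4.
- by rewrite -genG genS // !subUset !sub1set !inE !eqxx !orbT.
- by rewrite -xy2 mem_gen // !inE eqxx.
- by rewrite mem_gen // !inE eqxx.
- by rewrite mem_gen // !inE eqxx.
- rewrite subUset !sub1set; apply/andP.
  by split; first apply: groupX; rewrite mem_gen // !inE eqxx ?orbT.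
- by rewrite mem_gen // !inE eqxx.
- by rewrite genS // !subUset !sub1set !inE !eqxx !orbT.
- by move=> mu _; apply: csqrtP.
- move=> mu psi _ lin_psi; split=> [[psi_x eq_z] | [eq_psi ->]].
    split=> // s; rewrite !inE => /orP[] /eqP-> //.
    by rewrite lin_charX ?psi_x ?csqrtP // mem_gen // !inE eqxx.
  by split=> //; apply: eq_psi; rewrite !inE eqxx orbT.
by move=> mu _; right; rewrite -xy2.
Qed.
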